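(* Let $G$ be a connected reductive complex Lie group acting effectively and holomorphically on a connected complex manifold $Y$ that is $G$-elliptic, and let $Y'$ be a covering of $Y$ such that a finite covering $G'$ of $G$ acts on $Y'$ covering the action of $G$ on $Y$. Then $Y'$ is $G'$-elliptic. In particular, this holds if $Y'\to Y$ is a finite covering.
   Context: A reductive complex Lie group is the complexification of a compact Lie group. Coverings of manifolds are unbranched; $Y'$ carries the complex structure pulled back from $Y$. The group $G'$ is the quotient of the universal covering group of $G$ that acts effectively on $Y'$; its action on $Y'$ covers the action of $G$ on $Y$, i.e. $Y'\to Y$ is equivariant with respect to $G'\to G$. The last sentence means that if $Y'\to Y$ is a finite covering, then such a finite covering $G'$ of $G$ exists and $Y'$ is $G'$-elliptic. A spray on a complex manifold $Y$ is a holomorphic map $s:E\to Y$ defined on the total space of a holomorphic vector bundle $E$ over $Y$ such that $s(0_y)=y$ for all $y\in Y$. It is dominating if for every $y\in Y$, $s|_{E_y}:E_y\to Y$ is a submersion at $0_y$. If $G$ acts on $Y$, $s$ is a $G$-spray if the $G$-action on $Y$ lifts to a holomorphic action of $G$ on $E$ by vector bundle isomorphisms such that both $s$ and the projection $E\to Y$ are equivariant. $Y$ is $G$-elliptic if it admits a dominating $G$-spray. *)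

(* Defs.v *)
From HB Require Import structures.
From mathcomp Require Import all_boot all_order all_algebra.
From mathcomp Require Import complex.
From mathcomp Require Import all_classical all_reals all_analysis.
Set Implicit Arguments.
Unset Strict Implicit.
Unset Printing Implicit Defensive.
Import Order.TTheory GRing.Theory Num.Theory.
Import numFieldNormedType.Exports.
Local Open Scope classical_set_scope.
Local Open Scope ring_scope.

(* A manifold modelled on K^n is described by an atlas, not necessarily       *)
(* maximal, whose transition maps are regular.  With K = R[i] and regular     *)
(* meaning holomorphic this gives complex manifolds; with K = R and regular   *)
(* meaning C^oo it gives real manifolds, used only for compact Lie groups.    *)
(* All complex manifolds are pure-dimensional.                                *)

Definition regularity (K : numFieldType) :=
  forall m n : nat, set 'rV[K]_m -> ('rV[K]_m -> 'rV[K]_n) -> Prop.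

(* Used on open sets U only: differentiable is Frechet differentiability with *)
(* a K-linear differential, which for K = R[i] is holomorphy.                 *)
Definition differentiable_on (K : numFieldType) : regularity K :=
  fun m n U f => forall x, U x -> differentiable f x.

Fixpoint Ck_on (K : numFieldType) (m n : nat) (U : set 'rV[K]_m) (k : nat)
    (f : 'rV[K]_m -> 'rV[K]_n) : Prop :=
  (forall x, U x -> {for x, continuous f}) /\
  if k is k'.+1 then
    forall v, (forall x, U x -> derivable f x v) /\
      Ck_on U k' (fun x => 'D_v f x)
  else True.

Definition smooth_on (K : numFieldType) : regularity K :=
  fun m n U f => forall k, Ck_on U k f.

(* chart_map is only meaningful on chart_dom, and chart_inv on its image.     *)
Record chart (K : numFieldType) (T : Type) (n : nat) := Chart {
  chart_dom : set T ;
  chart_map :> T -> 'rV[K]_n ;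
  chart_inv : 'rV[K]_n -> T }.

Definition is_chart (K : numFieldType) (T : topologicalType) (n : nat)
    (c : chart K T n) : Prop :=
  [/\ open (chart_dom c), open (c @` chart_dom c),
      (forall x, chart_dom c x -> chart_inv c (c x) = x),
      {within chart_dom c, continuous c} &
      {within c @` chart_dom c, continuous (chart_inv c)}].

Definition model_chart (K : numFieldType) (n : nat) : chart K 'rV[K]_n n :=
  Chart setT id id.

Definition model_atlas (K : numFieldType) (n : nat) :
  set (chart K 'rV[K]_n n) := [set model_chart K n].

Arguments model_atlas K n : clear implicits.

Definition prod_chart (K : numFieldType) (T S : Type) (m n : nat)
    (c : chart K T m) (d : chart K S n) : chart K (T * S) (m + n) :=
  Chart (chart_dom c `*` chart_dom d)
    (fun z => row_mx (c z.1) (d z.2))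
    (fun u => (chart_inv c (lsubmx u), chart_inv d (rsubmx u))).

Definition prod_atlas (K : numFieldType) (T S : Type) (m n : nat)
    (A : set (chart K T m)) (B : set (chart K S n)) :
    set (chart K (T * S) (m + n)) :=
  [set e | exists c d, [/\ A c, B d & e = prod_chart c d]].

Definition compatible (K : numFieldType) (reg : regularity K) (T : Type)
    (n : nat) (c d : chart K T n) : Prop :=
  reg n n (c @` (chart_dom c `&` chart_dom d)) (d \o chart_inv c) /\
  reg n n (d @` (chart_dom c `&` chart_dom d)) (c \o chart_inv d).

Definition is_manifold (K : numFieldType) (reg : regularity K)
    (T : topologicalType) (n : nat) (A : set (chart K T n)) : Prop :=
  [/\ hausdorff_space T, @second_countable T,
      (forall c, A c -> is_chart c),
      (forall x, exists2 c, A c & chart_dom c x) &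
      (forall c d, A c -> A d -> compatible reg c d)].

(* Regularity, on an open subset D of T, of f with respect to given atlases.  *)
Definition regular_map_on (K : numFieldType) (reg : regularity K)
    (T S : topologicalType) (m n : nat)
    (A : set (chart K T m)) (B : set (chart K S n))
    (D : set T) (f : T -> S) : Prop :=
  (forall x, D x -> {for x, continuous f}) /\
  (forall c d, A c -> B d ->
    reg m n (c @` (chart_dom c `&` D `&` f @^-1` chart_dom d))
      (d \o f \o chart_inv c)).

Definition regular_iso_on (K : numFieldType) (reg : regularity K)
    (T S : topologicalType) (m n : nat)
    (A : set (chart K T m)) (B : set (chart K S n))
    (D : set T) (D' : set S) (f : T -> S) : Prop :=
  exists g : S -> T,
    [/\ (forall x, D x -> D' (f x) /\ g (f x) = x),
        (forall y, D' y -> D (g y) /\ f (g y) = y),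
        regular_map_on reg A B D f & regular_map_on reg B A D' g].

Record manifold (K : numFieldType) (reg : regularity K) (n : nat) := Manifold {
  manifold_sort :> topologicalType ;
  atlas : set (chart K manifold_sort n) ;
  atlasP : is_manifold reg atlas }.

#[short(type="groupTopologicalType")]
HB.structure Definition GroupTopological := {T of Group T & Topological T}.

Record lieGroup (K : numFieldType) (reg : regularity K) (n : nat) := LieGroup {
  lie_sort :> groupTopologicalType ;
  lie_atlas : set (chart K lie_sort n) ;
  lie_atlasP : is_manifold reg lie_atlas ;
  lie_mulP : regular_map_on reg (prod_atlas lie_atlas lie_atlas) lie_atlas
    setT (fun z => z.1 * z.2)%g ;
  lie_invP : regular_map_on reg lie_atlas lie_atlas setT (fun x => x^-1)%g }.

Arguments atlas {K reg n} m.
Arguments lie_atlas {K reg n} l.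

(* From here on regular means differentiable over K; the final statement is   *)
(* about K = R[i], where this is holomorphy.                                  *)
Notation holManifold K := (manifold (@differentiable_on K)).
Notation holLieGroup K := (lieGroup (@differentiable_on K)).

Definition holomorphic_on (K : numFieldType) (T S : topologicalType) (m n : nat)
    (A : set (chart K T m)) (B : set (chart K S n)) (D : set T) (f : T -> S) : Prop :=
  regular_map_on (@differentiable_on _) A B D f.

Definition submersion_at (K : numFieldType) (T S : topologicalType) (m n : nat)
    (A : set (chart K T m)) (B : set (chart K S n)) (f : T -> S) (x : T) : Prop :=
  forall c d, A c -> B d -> chart_dom c x -> chart_dom d (f x) ->
    let g := d \o f \o chart_inv c in
    differentiable g (c x) /\ forall w, exists v, 'd g (c x) v = w.

Record holomorphic_action (K : numFieldType) (m n : nat) (G : holLieGroup K m)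
    (Y : holManifold K n) := HolomorphicAction {
  act :> G -> Y -> Y ;
  act1 : forall y, act 1%g y = y ;
  actM : forall g h y, act (g * h)%g y = act g (act h y) ;
  act_holomorphic : holomorphic_on (prod_atlas (lie_atlas G) (atlas Y))
    (atlas Y) setT (fun z => act z.1 z.2) }.

Definition effective (K : numFieldType) (m n : nat) (G : holLieGroup K m)
    (Y : holManifold K n) (a : holomorphic_action G Y) : Prop :=
  forall g, (forall y, a g y = y) -> g = 1%g.

(* vb_add e e' is only meaningful when e and e' lie in the same fibre.  The   *)
(* fibrewise vector space axioms follow from the local trivializations.       *)
Record vectorBundle (K : numFieldType) (n : nat) (Y : holManifold K n)
    (r : nat) := VectorBundle {
  vb_total :> holManifold K (n + r) ;
  vb_proj : vb_total -> Y ;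
  vb_zero : Y -> vb_total ;
  vb_add : vb_total -> vb_total -> vb_total ;
  vb_scale : K -> vb_total -> vb_total ;
  vb_proj_zero : forall y, vb_proj (vb_zero y) = y ;
  vb_proj_add : forall e e', vb_proj e = vb_proj e' ->
    vb_proj (vb_add e e') = vb_proj e ;
  vb_proj_scale : forall a e, vb_proj (vb_scale a e) = vb_proj e ;
  vb_locally_trivial : forall y0 : Y,
    exists (U : set Y) (tau : vb_total -> 'rV[K]_r),
      [/\ open_nbhs y0 U,
          regular_iso_on (@differentiable_on _) (atlas vb_total)
            (prod_atlas (atlas Y) (model_atlas _ r))
            (vb_proj @^-1` U) (U `*` setT) (fun e => (vb_proj e, tau e)),
          (forall y, U y -> tau (vb_zero y) = 0),
          (forall e e', U (vb_proj e) -> vb_proj e = vb_proj e' ->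
            tau (vb_add e e') = tau e + tau e') &
          (forall a e, U (vb_proj e) -> tau (vb_scale a e) = a *: tau e)] }.

Section Sprays.
Variables (K : numFieldType) (m n r : nat) (G : holLieGroup K m)
  (Y : holManifold K n) (a : holomorphic_action G Y)
  (E : vectorBundle Y r).

Definition is_spray (s : E -> Y) : Prop :=
  holomorphic_on (atlas E) (atlas Y) setT s /\
  forall y, s (vb_zero E y) = y.

(* psi is a linear isomorphism from K^r onto the fibre E_y.                   *)
Definition fiber_frame (y : Y) (psi : 'rV[K]_r -> E) : Prop :=
  set_bij setT (vb_proj (v := E) @^-1` [set y]) psi /\
  forall b u v, psi (b *: u + v) = vb_add (vb_scale b (psi u)) (psi v).

Definition dominating (s : E -> Y) : Prop :=
  forall y psi, fiber_frame y psi ->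
    submersion_at (model_atlas _ r) (atlas Y) (s \o psi) 0.

(* The maps b g are fibrewise linear, hence bundle isomorphisms since b is an *)
(* action.                                                                    *)
Definition equivariant_spray (s : E -> Y) : Prop :=
  exists b : holomorphic_action G E,
    [/\ (forall g e, vb_proj (b g e) = a g (vb_proj e)),
        (forall g e e', vb_proj e = vb_proj e' ->
          b g (vb_add e e') = vb_add (b g e) (b g e')),
        (forall g c e, b g (vb_scale c e) = vb_scale c (b g e)) &
        (forall g e, s (b g e) = a g (s e))].

End Sprays.

Definition elliptic (K : numFieldType) (m n : nat) (G : holLieGroup K m)
    (Y : holManifold K n) (a : holomorphic_action G Y) : Prop :=
  exists (r : nat) (E : vectorBundle Y r) (s : E -> Y),
    [/\ is_spray s, dominating s & equivariant_spray a s].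

Definition evenly_covered (T S : topologicalType) (p : T -> S) (V : set S) :
    Prop :=
  exists F : set (set T),
    [/\ trivIset F id, \bigcup_(B in F) B = p @^-1` V &
        forall B, F B ->
          [/\ open B, set_bij B V p &
              forall W, open W -> W `<=` B -> open (p @` W)]].

Definition covering_map (T S : topologicalType) (p : T -> S) : Prop :=
  [/\ continuous p, set_surj setT setT p &
      forall y, exists2 V, open_nbhs y V & evenly_covered p V].

Definition finite_fibers (T S : Type) (p : T -> S) : Prop :=
  forall y, finite_set (p @^-1` [set y]).

Definition pullback_atlas (K : numFieldType) (T S : topologicalType) (n : nat)
    (p : T -> S) (A : set (chart K S n)) : set (chart K T n) :=
  [set c' | is_chart c' /\ exists c,
    [/\ A c, chart_dom c' `<=` p @^-1` chart_dom c &
        forall x, chart_dom c' x -> c' x = c (p x)]].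

(* The complex structure defined by A' is the one pulled back from A.         *)
Definition pulled_back (K : numFieldType) (T S : topologicalType) (n : nat)
    (p : T -> S) (A' : set (chart K T n)) (A : set (chart K S n)) : Prop :=
  forall c c', A' c -> pullback_atlas p A c' ->
    compatible (@differentiable_on _) c c'.

Definition manifold_covering (K : numFieldType) (n : nat)
    (Y' Y : holManifold K n) (p : Y' -> Y) : Prop :=
  covering_map p /\ pulled_back p (atlas Y') (atlas Y).

(* A connected covering group of G, that is, a quotient of the universal      *)
(* covering group of G by a subgroup of the kernel of its projection to G.    *)
Definition covering_group (K : numFieldType) (m : nat)
    (G' G : holLieGroup K m) (q : G' -> G) : Prop :=
  [/\ connected [set: G'], {morph q : x y / (x * y)%g}, covering_map q &
      pulled_back q (lie_atlas G') (lie_atlas G)].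

Definition action_covers (K : numFieldType) (m n : nat)
    (G' G : holLieGroup K m) (Y' Y : holManifold K n)
    (q : G' -> G) (p : Y' -> Y)
    (a' : holomorphic_action G' Y') (a : holomorphic_action G Y) : Prop :=
  forall g y, p (a' g y) = a (q g) (p y).

Definition complex_field (R : realType) : numFieldType := R[i].

Notation complexManifold R := (holManifold (complex_field R)).
Notation complexLieGroup R := (holLieGroup (complex_field R)).
Notation realLieGroup R := (lieGroup (@smooth_on R)).

(* The universal complexification of K0: continuous homomorphisms from K0 to  *)
(* complex Lie groups (which are automatically C^oo) factor uniquely through  *)
(* holomorphic homomorphisms from G.                                          *)
Definition is_complexification (R : realType) (k m : nat)
    (K0 : realLieGroup R k) (G : complexLieGroup R m) (iota : K0 -> G) : Prop :=
  [/\ continuous iota, {morph iota : x y / (x * y)%g} &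
    forall (h : nat) (H : complexLieGroup R h) (f : K0 -> H),
      continuous f -> {morph f : x y / (x * y)%g} ->
      exists! F : G -> H,
        [/\ holomorphic_on (lie_atlas G) (lie_atlas H) setT F,
            {morph F : x y / (x * y)%g} & f = F \o iota]].

Definition reductive (R : realType) (m : nat) (G : complexLieGroup R m) :
    Prop :=
  exists (k : nat) (K0 : realLieGroup R k) (iota : K0 -> G),
    compact [set: K0] /\ is_complexification iota.

(* Main.v *)
(* Everything is transported through coverings by unique path lifting.  Let
   [s : E -> Y] be a dominating [G]-spray.  The pulled back spray lives on the
   bundle [p^*E] and sends [(y', e)] to the end point of the lift, starting at
   [y'], of the path [t |-> s (t e)].  It is holomorphic and dominating because
   [p] is a local biholomorphism, and equivariant because lifts are unique.

   If [p] has finite fibres, [G'] is the group of pairs [(g, phi)] where [phi]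
   is the end of an isotopy of [Y'] lifting the action on [Y] of a path from [1]
   to [g] in [G].  For [u] near [1], straight paths in a chart give such a lift
   [mu u] depending continuously on [u]; the right translates of the local
   section [u |-> (u, mu u)] define the topology of [G'] and are the sheets of
   [G' -> G].  Since [Y] is connected, an element over a given [g] is determined
   by its values on one fibre of [p], so that [G' -> G] has finite fibres. *)

From HB Require Import structures.
Require Import Defs.
From mathcomp Require Import all_boot all_order all_algebra.
From mathcomp Require Import complex.
From mathcomp Require Import all_classical all_reals all_analysis.
Import Order.TTheory GRing.Theory Num.Theory.
Import numFieldNormedType.Exports.
Set Implicit Arguments.
Unset Strict Implicit.
Unset Printing Implicit Defensive.
Local Open Scope classical_set_scope.
Local Open Scope ring_scope.

(** * Calculus and charts *)

(** The complex structures on p^*E and on G' are pulled back along local homeomorphisms to [E] and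
    [G], so a continuous lift of a holomorphic map is holomorphic; what mainly remains is topology.
    There the obstacle is that [Y'] may be disconnected, and that a function space topology on the
    lifts would still have to be shown to make them a manifold. So lifts are compared over whole
    fibres, by a connectedness argument on [Y] in which finiteness of the fibres allows
    neighbourhoods to be intersected. Right translates of a section are not adapted to left
    multiplication; the missing link is that conjugating the local section by any element gives the
    local section again near 1. Finiteness enters once more to make G' second countable. The scalars
    are a general [K] with a continuous map [iota] from the reals that preserves 0 and 1 and turns
    time into a scalar; for segments in charts it must also send [0, 1] into the unit ball. *)

Section Differentiability.
Variable K : numFieldType.

(** Charts are total functions with arbitrary values outside their domains, so chart changes cancel
    only near a point. This makes such local identities usable for differentials. *)
Lemma differentiable_near (V W : normedModType K) (f g : V -> W) (x : V) :
  (\forall y \near x, f y = g y) -> differentiable f x ->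
  differentiable g x /\ 'd g x = 'd f x :> (V -> W).
Proof.
move=> fg df; have fgx : f x = g x by exact: nbhs_singleton fg.
have dg : g \o shift x = cst (g x) + 'd f x +o_ 0 id.
  apply/eqaddoP => e e0.
  have /eqaddoP /(_ e e0) := diff_locally df.
  have : \forall y \near (0 : V), f (y + x) = g (y + x).
    have c : {for 0, continuous (fun y : V => y + x)}.
      by apply: cvgD; [exact: cvg_id|exact: cvg_cst].
    by apply: (c [set y | f y = g y]); rewrite add0r.
  apply: filterS2 => y fgy.
  by rewrite !fctE /= fgy fgx.
have dfc := diff_continuous df.
have dgE := diff_unique dfc dg; split => //.
by apply/diff_locallyP; rewrite dgE; split.
Qed.

(** On K^m a linear map is a finite sum of coordinates times fixed vectors, so continuity comes from
    finite dimension. *)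
Lemma rV_linear_differentiable (V : normedModType K) (m : nat)
    (f : {linear 'rV[K]_m -> V}) x : differentiable f x.
Proof.
have -> : (f : _ -> _) =
    \sum_(i < m) (fun u : 'rV[K]_m => u 0 i *: f (delta_mx 0 i)).
  apply/funext => u; rewrite fct_sumE [in LHS](row_sum_delta u) linear_sum.
  by apply: eq_bigr => i _; rewrite linearZ.
apply: differentiable_sum => i; apply: differentiableZl.
exact: differentiable_coord.
Qed.

Lemma differentiable_row_mx (V : normedModType K) (m n : nat)
    (f : V -> 'rV[K]_m) (g : V -> 'rV[K]_n) x :
  differentiable f x -> differentiable g x ->
  differentiable (fun v => row_mx (f v) (g v)) x.
Proof.
move=> df dg.
have l1 : linear (fun u : 'rV[K]_m => row_mx u (0 : 'rV[K]_n)).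
  by move=> a u v; rewrite scale_row_mx add_row_mx scaler0 addr0.
have l2 : linear (fun u : 'rV[K]_n => row_mx (0 : 'rV[K]_m) u).
  by move=> a u v; rewrite scale_row_mx add_row_mx scaler0 addr0.
pose L1 : {linear 'rV[K]_m -> 'rV[K]_(m + n)} :=
  HB.pack (fun u : 'rV[K]_m => row_mx u (0 : 'rV[K]_n))
    (GRing.isLinear.Build _ _ _ _ _ l1).
pose L2 : {linear 'rV[K]_n -> 'rV[K]_(m + n)} :=
  HB.pack (fun u : 'rV[K]_n => row_mx (0 : 'rV[K]_m) u)
    (GRing.isLinear.Build _ _ _ _ _ l2).
have -> : (fun v => row_mx (f v) (g v)) = (L1 \o f) + (L2 \o g).
  by apply/funext => v; rewrite !fctE /= add_row_mx addr0 add0r.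
by apply: differentiableD; apply: differentiable_comp => //;
  exact: rV_linear_differentiable.
Qed.

(** Since [t \o s] is the identity near [t (h x)], the differential of [t] is onto with right
    inverse that of [s]; a preimage of [w] is found by solving for ['d s w] with ['d h x]. In use
    [t] is a change of charts. *)
Lemma diff_surj_comp (U V W : normedModType K) (h : U -> V) (t : V -> W)
    (s : W -> V) (g : U -> W) x :
  differentiable h x -> differentiable t (h x) -> differentiable s (t (h x)) ->
  s (t (h x)) = h x -> (\forall w \near t (h x), t (s w) = w) ->
  (\forall y \near x, t (h y) = g y) ->
  (forall v, exists u, 'd h x u = v) ->
  differentiable g x /\ forall w, exists u, 'd g x u = w.
Proof.
move=> dh dt ds sth ts thg hsurj.
have [dg dgE] := differentiable_near thg (differentiable_comp dh dt).
split=> [//|w]; have [u hu] := hsurj ('d s (t (h x)) w).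
exists u; rewrite dgE diff_comp //= hu.
have idw : \forall w \near t (h x), w = (t \o s) w.
  by apply: filterS ts => y /= ->.
have idd : differentiable (idfun : W -> W) (t (h x)).
  by apply: (@linear_differentiable _ _ _ idfun) => ?.
have [_] := differentiable_near idw idd.
rewrite (@diff_lin _ _ _ idfun); last by move=> ?.
rewrite diff_comp ?sth // => /(congr1 (fun k : W -> W => k w)) /=.
by [].
Qed.

End Differentiability.

Lemma continuous_pair_at (X T S : topologicalType) (f : X -> T) (g : X -> S) x :
  {for x, continuous f} -> {for x, continuous g} ->
  {for x, continuous (fun z => (f z, g z))}.
Proof. exact: cvg_pair. Qed.

Lemma continuous_fst (T S : topologicalType) : continuous (@fst T S).
Proof. by move=> x; exact: cvg_fst. Qed.

Lemma continuous_snd (T S : topologicalType) : continuous (@snd T S).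
Proof. by move=> x; exact: cvg_snd. Qed.

Section Charts.
Variable K : numFieldType.

Section OneChart.
Variables (T : topologicalType) (n : nat) (c : chart K T n).
Hypothesis cc : is_chart c.

Lemma chart_dom_near x : chart_dom c x -> nbhs x (chart_dom c).
Proof. by case: cc => oc _ _ _ _ cx; apply: open_nbhs_nbhs. Qed.

Lemma chart_continuous x : chart_dom c x -> {for x, continuous c}.
Proof.
case: cc => oc _ _ + _ cx; rewrite continuous_open_subspace // => cont.
by apply: cont; rewrite inE.
Qed.

Lemma chart_inv_continuous x :
  chart_dom c x -> {for c x, continuous (chart_inv c)}.
Proof.
case: cc => _ oc _ _ + cx; rewrite continuous_open_subspace // => cont.
by apply: cont; rewrite inE; exists x.
Qed.

Lemma chart_invK x : chart_dom c x -> chart_inv c (c x) = x.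
Proof. by case: cc => _ _ + _ _; apply. Qed.

Lemma chart_inv_near x (P : set T) : chart_dom c x -> nbhs x P ->
  \forall u \near c x, [/\ chart_dom c (chart_inv c u),
    c (chart_inv c u) = u & P (chart_inv c u)].
Proof.
move=> cx Px.
have Pn : \forall u \near c x, P (chart_inv c u).
  by apply: chart_inv_continuous => //; rewrite chart_invK.
have : nbhs (c x) (c @` chart_dom c).
  by case: cc => _ oc _ _ _; apply: open_nbhs_nbhs; split => //; exists x.
apply: filterS2 Pn => u Pu [z cz zu]; split => //.
  by rewrite -zu chart_invK.
by rewrite -zu chart_invK.
Qed.

End OneChart.

(** Pointwise form of [holomorphic_on]; it depends only on the germ of [f], which suits maps given
    by local formulas. *)
Definition hol_at (T S : topologicalType) (m n : nat) (A : set (chart K T m))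
    (B : set (chart K S n)) (f : T -> S) (x : T) : Prop :=
  {for x, continuous f} /\
  forall c d, A c -> B d -> chart_dom c x -> chart_dom d (f x) ->
    differentiable (d \o f \o chart_inv c) (c x).

Lemma holomorphic_onP (T S : topologicalType) (m n : nat)
    (A : set (chart K T m)) (B : set (chart K S n)) (D : set T) (f : T -> S) :
  holomorphic_on A B D f <-> forall x, D x -> hol_at A B f x.
Proof.
split=> [[fc fd] x Dx|fh].
  by split=> [|c d Ac Bd cx dx]; [exact: fc|apply: fd => //; exists x].
split=> [x /fh[]//|c d Ac Bd u [x [[cx Dx] dx] <-]].
by have [_] := fh x Dx; exact.
Qed.

Variables (T S : topologicalType) (m n : nat).
Variables (A : set (chart K T m)) (B : set (chart K S n)).
Hypothesis Ac : forall c, A c -> is_chart c.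

Lemma hol_at_near (f g : T -> S) x :
  (\forall y \near x, f y = g y) -> hol_at A B f x -> hol_at A B g x.
Proof.
move=> fg [fc fd]; have fgx := nbhs_singleton fg.
split=> [|c d cA dB cx dx].
  change (g @ x --> g x); rewrite -fgx.
  by apply: cvg_trans fc; apply: near_eq_cvg.
have := fd c d cA dB cx; rewrite fgx => /(_ dx) df.
apply: (proj1 (differentiable_near _ df)).
have := chart_inv_near (Ac cA) cx fg.
by apply: filterS => u [_ _ /= ->].
Qed.

Lemma hol_at_comp (U : topologicalType) (k : nat) (C : set (chart K U k))
    (f : T -> S) (g : S -> U) x :
  (forall d, B d -> is_chart d) -> (forall y, exists2 d, B d & chart_dom d y) ->
  hol_at A B f x -> hol_at B C g (f x) -> hol_at A C (g \o f) x.
Proof.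
move=> Bc Bcov [fc fd] [gc gd]; split; first exact: continuous_comp.
move=> c e cA eC cx ex; have [d dB dx] := Bcov (f x).
have h1 := fd c d cA dB cx dx; have h2 := gd d e dB eC dx ex.
have : differentiable ((e \o g \o chart_inv d) \o (d \o f \o chart_inv c)) (c x).
  apply: differentiable_comp => //.
  by rewrite /= (chart_invK (Ac cA)).
move=> df; apply: (proj1 (differentiable_near _ df)).
have fd' : nbhs x (f @^-1` chart_dom d) by apply: fc; apply: chart_dom_near; auto.
have := chart_inv_near (Ac cA) cx fd'.
by apply: filterS => u [_ _ /= du]; rewrite (chart_invK (Bc _ dB)).
Qed.

Lemma hol_at_id x : (forall c d, A c -> A d ->
  compatible (@differentiable_on K) c d) -> hol_at A A id x.
Proof.
move=> comp; split; first exact: cvg_id.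
by move=> c d cA dA cx dx; have [+ _] := comp c d cA dA; apply; exists x.
Qed.

Lemma prod_atlas_chart : (forall d, B d -> is_chart d) ->
  forall e, prod_atlas A B e -> is_chart e.
Proof.
move=> Bc e [c [d [cA dB ->]]].
have [oc oc' cK cc ci] := Ac cA; have [od od' dK dc di] := Bc _ dB.
have imE : prod_chart c d @` chart_dom (prod_chart c d) =
    (lsubmx @^-1` (c @` chart_dom c)) `&` (rsubmx @^-1` (d @` chart_dom d)).
  apply/seteqP; split=> [u [[x y] /= [cx dy] <-]|u [/= [x cx xu] [y dy yu]]].
    by split; rewrite /= ?row_mxKl ?row_mxKr; [exists x|exists y].
  by exists (x, y) => //=; rewrite xu yu hsubmxK.
have oim : open (prod_chart c d @` chart_dom (prod_chart c d)).
  rewrite imE; apply: openI; apply: open_comp => // u _.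
    exact: continuous_lsubmx.
  exact: continuous_rsubmx.
have odom : open (chart_dom (prod_chart c d)).
  rewrite (_ : chart_dom _ =
    (fst @^-1` chart_dom c) `&` (snd @^-1` chart_dom d)) //.
  by apply: openI; apply: open_comp => // u _; [exact: cvg_fst|exact: cvg_snd].
split=> //.
- by move=> [x y] /= [cx dy]; rewrite row_mxKl row_mxKr cK ?dK.
- rewrite continuous_open_subspace // => -[x y]; rewrite inE => -[/= cx dy].
  change {for (x, y), continuous
    ((fun z : 'rV[K]_m * 'rV[K]_n => row_mx z.1 z.2) \o
     (fun z : T * S => (c z.1, d z.2)))}.
  apply: continuous_comp.
    apply: continuous_pair_at.
      apply: (@continuous_comp _ _ _ fst c); first exact: continuous_fst.
      exact: (chart_continuous (Ac cA)).
    apply: (@continuous_comp _ _ _ snd d); first exact: continuous_snd.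
    exact: (chart_continuous (Bc _ dB)).
  apply: differentiable_continuous; apply: differentiable_row_mx.
    by apply: linear_differentiable => z; exact: cvg_fst.
  by apply: linear_differentiable => z; exact: cvg_snd.
- rewrite continuous_open_subspace // => u; rewrite inE imE.
  move=> -[/= [x cx xu] [y dy yu]].
  apply: (@continuous_pair_at _ _ _ (chart_inv c \o lsubmx)
      (chart_inv d \o rsubmx)); apply: continuous_comp.
  - exact: continuous_lsubmx.
  - by rewrite -xu; exact: (chart_inv_continuous (Ac cA)).
  - exact: continuous_rsubmx.
  - by rewrite -yu; exact: (chart_inv_continuous (Bc _ dB)).
Qed.

End Charts.

(** * Atlases and local homeomorphisms *)

Section Atlases.
Variables (K : numFieldType) (T : topologicalType) (n : nat).
Variable A : set (chart K T n).

Definition is_atlas : Prop := [/\ (forall c, A c -> is_chart c),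
  (forall x, exists2 c, A c & chart_dom c x) &
  (forall c d, A c -> A d -> compatible (@differentiable_on K) c d)].

Lemma manifold_atlas : is_manifold (@differentiable_on K) A -> is_atlas.
Proof. by case. Qed.

Hypothesis aA : is_atlas.

Lemma atlas_chart c : A c -> is_chart c.
Proof. by case: aA => + _ _; apply. Qed.

Lemma atlas_cover x : exists2 c, A c & chart_dom c x.
Proof. by case: aA => _ + _; apply. Qed.

Lemma atlas_compatible c d :
  A c -> A d -> compatible (@differentiable_on K) c d.
Proof. by case: aA => _ _ + cA dA; apply. Qed.

Lemma atlas_hol_id x : hol_at A A id x.
Proof. exact: (hol_at_id x atlas_compatible). Qed.

End Atlases.

Lemma model_is_atlas (K : numFieldType) (n : nat) : is_atlas (model_atlas K n).
Proof.
split.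
- move=> _ ->; have imT : [set id x | x in [set: 'rV[K]_n]] = setT.
    by apply/seteqP; split=> // x _; exists x.
  split=> //=.
  + exact: openT.
  + by rewrite imT; exact: openT.
  + by apply: continuous_subspaceT => x; exact: cvg_id.
  + by apply: continuous_subspaceT => x; exact: cvg_id.
- by move=> x; exists (model_chart K n).
- move=> _ _ -> ->; split=> x _.
    by apply: (@linear_differentiable _ _ _ idfun) => ?.
  by apply: (@linear_differentiable _ _ _ idfun) => ?.
Qed.

Section Products.
Variables (K : numFieldType) (T S : topologicalType) (m n : nat).
Variables (A : set (chart K T m)) (B : set (chart K S n)).
Hypothesis aA : is_atlas A.
Hypothesis aB : is_atlas B.

Lemma prod_is_chart e : prod_atlas A B e -> is_chart e.
Proof. exact: (prod_atlas_chart (atlas_chart aA) (atlas_chart aB)). Qed.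

Lemma prod_atlas_cover z : exists2 e, prod_atlas A B e & chart_dom e z.
Proof.
have [c cA cz] := atlas_cover aA z.1.
have [d dB dz] := atlas_cover aB z.2.
by exists (prod_chart c d) => //; exists c, d.
Qed.

Lemma hol_at_fst z : hol_at (prod_atlas A B) A fst z.
Proof.
split; first exact: continuous_fst.
move=> _ c' [c [d [cA dB ->]]] c'A [/= cz dz] c'z.
have -> : c' \o fst \o chart_inv (prod_chart c d) =
  (c' \o chart_inv c) \o lsubmx by [].
apply: differentiable_comp; first exact: differentiable_lsubmx.
rewrite row_mxKl; have [+ _] := atlas_compatible aA cA c'A.
by apply; exists z.1.
Qed.

Lemma hol_at_snd z : hol_at (prod_atlas A B) B snd z.
Proof.
split; first exact: continuous_snd.
move=> _ d' [c [d [cA dB ->]]] d'B [/= cz dz] d'z.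
have -> : d' \o snd \o chart_inv (prod_chart c d) =
  (d' \o chart_inv d) \o rsubmx by [].
apply: differentiable_comp; first exact: differentiable_rsubmx.
rewrite row_mxKr; have [+ _] := atlas_compatible aB dB d'B.
by apply; exists z.2.
Qed.

Lemma hol_at_pair (X : topologicalType) (k : nat) (C : set (chart K X k))
    (f : X -> T) (g : X -> S) x :
  hol_at C A f x -> hol_at C B g x ->
  hol_at C (prod_atlas A B) (fun z => (f z, g z)) x.
Proof.
move=> [fc fd] [gc gd]; split; first exact: continuous_pair_at.
move=> e _ eC [c [d [cA dB ->]]] ex [/= cx dx].
apply: (@differentiable_row_mx _ _ _ _ (c \o f \o chart_inv e)
  (d \o g \o chart_inv e)); [exact: fd|exact: gd].
Qed.

End Products.

Lemma hol_at_prod_map (K : numFieldType) (T S T' S' : topologicalType)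
    (m n m' n' : nat) (A : set (chart K T m)) (B : set (chart K S n))
    (A' : set (chart K T' m')) (B' : set (chart K S' n'))
    (f : T -> T') (g : S -> S') z :
  is_atlas A -> is_atlas B ->
  hol_at A A' f z.1 -> hol_at B B' g z.2 ->
  hol_at (prod_atlas A B) (prod_atlas A' B') (fun z => (f z.1, g z.2)) z.
Proof.
move=> aA aB hf hg.
apply: (@hol_at_pair _ _ _ _ _ _ _ _ _ _ (f \o fst) (g \o snd)).
  exact: (hol_at_comp (prod_is_chart aA aB)
    (atlas_chart aA) (atlas_cover aA) (hol_at_fst B aA z) hf).
exact: (hol_at_comp (prod_is_chart aA aB)
  (atlas_chart aB) (atlas_cover aB) (hol_at_snd A aB z) hg).
Qed.

Section Sheets.
Variables (T S : topologicalType) (p : T -> S).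

(** The inverse of [p : B -> V] is carried along as a total function [s], meaningful on [V] only, so
    that lifting into the sheet is composition with [s]. *)
Definition sheet (V : set S) (B : set T) (s : S -> T) : Prop :=
  [/\ open V, open B, (forall y, V y -> B (s y) /\ p (s y) = y),
      (forall z, B z -> V (p z) /\ s (p z) = z) &
      forall y, V y -> {for y, continuous s}].

(** Weaker than a covering and enough to transport atlases; [pb2] enters the proof in this form,
    with sheets coming from those of [p]. *)
Definition local_homeo : Prop := continuous p /\
  forall x, exists V B s, sheet V B s /\ B x.

Lemma evenly_covered_sheet V x : open V -> evenly_covered p V -> V (p x) ->
  exists B s, sheet V B s /\ B x.
Proof.
move=> oV [F [_ Fp FB]] Vx.
have : (p @^-1` V) x by [].
rewrite -Fp => -[B BF Bx]; have [oB [BV Binj Bsurj] pB] := FB B BF.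
(* [s] inverts [p] on [B], with junk value [x] off [V]; its continuity comes from the openness of
   [p] on [B]. *)
pose s y := if pselect (exists2 z, B z & p z = y) is left h
  then projT1 (cid2 h) else x.
have sP y : V y -> B (s y) /\ p (s y) = y.
  move=> Vy; rewrite /s; case: pselect => [h|[]]; first by case: (cid2 h).
  by have [z Bz zy] := Bsurj y Vy; exists z.
have sK z : B z -> V (p z) /\ s (p z) = z.
  move=> Bz; have Vz := BV z Bz; split => //.
  have [Bs ps] := sP _ Vz.
  by apply: Binj; rewrite ?inE.
exists B, s; split => //; split => // y Vy W sW.
have [W' [oW' W's] W'W] : exists2 W', open_nbhs (s y) W' & W' `<=` W.
  by move: sW; rewrite nbhsE.
have oW : open (p @` (W' `&` B)).
  by apply: pB; [exact: openI|move=> z []].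
have [Bs ps] := sP _ Vy.
suff : nbhs y (p @` (W' `&` B)).
  apply: filterS => _ [z [W'z Bz] <-]; apply: W'W.
  by have [_ ->] := sK _ Bz.
by apply: open_nbhs_nbhs; split => //; exists (s y).
Qed.

Lemma covering_local_homeo : covering_map p -> local_homeo.
Proof.
move=> [pc _ pV]; split => // x; have [V [oV Vx] eV] := pV (p x).
by have [B [s ?]] := evenly_covered_sheet oV eV Vx; exists V, B, s.
Qed.

Lemma sheetI V B s W : open W -> continuous p -> sheet V B s ->
  sheet (V `&` W) (B `&` p @^-1` W) s.
Proof.
move=> oW pc [oV oB sP sK sc]; split.
- exact: openI.
- by apply: openI => //; apply: open_comp.
- by move=> y [/sP[? ps] Wy]; split=> //; split => //=; rewrite ps.
- by move=> z [/sK[? ?] Wz].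
- by move=> y [/sc].
Qed.

End Sheets.

(** * Pulling back an atlas along a local homeomorphism *)

Section PullbackAtlas.
Variables (K : numFieldType) (T S : topologicalType) (n : nat) (p : T -> S).
Variable A : set (chart K S n).
Hypothesis aA : is_atlas A.
Hypothesis lp : local_homeo p.

(* The charts of [pullback_atlas] are only constrained on their domains: this
   one is [c \o p] as a total function. *)
Lemma pullback_chart x c : A c -> chart_dom c (p x) ->
  exists e, [/\ pullback_atlas p A e, chart_dom e x,
    chart_map e = c \o p & chart_dom e `<=` p @^-1` chart_dom c].
Proof.
move=> cA cx; have [pc /(_ x)[V [B [s [sh Bx]]]]] := lp.
have cc := atlas_chart aA cA.
have [oc oc' cK _ _] := cc.
have [oV oB sP sK sc] := sheetI oc pc sh.
set V' := V `&` chart_dom c in oV sP sK sc.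
set B' := B `&` p @^-1` chart_dom c in oB sP sK.
pose e := Chart B' (c \o p) (s \o chart_inv c).
have imE : e @` chart_dom e = c @` chart_dom c `&` (chart_inv c @^-1` V').
  apply/seteqP; split => [_ [z Bz <-]|_ [[y cy <-]]] /=.
    have [Vz _] := sK _ Bz; rewrite cK; last by case: Vz.
    by split => //; exists (p z) => //; case: Vz.
  rewrite cK // => Vy; have [Bs ps] := sP _ Vy.
  by exists (s y) => //=; rewrite ps.
have eP : is_chart e.
  split=> //.
  - rewrite imE openE => u [[y cy yu] Vu]; apply: filterI.
      by apply: open_nbhs_nbhs; split => //; exists y.
    have := chart_inv_continuous cc cy; rewrite yu; apply.
    by apply: open_nbhs_nbhs.
  - move=> z Bz /=; have [Vz sz] := sK _ Bz.
    by rewrite cK //; case: Vz.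
  - rewrite continuous_open_subspace // => z; rewrite inE => -[Bz cz].
    apply: continuous_comp; first exact: pc.
    exact: (chart_continuous cc).
  - rewrite continuous_open_subspace; last first.
      rewrite imE openE => u [[y cy yu] Vu]; apply: filterI.
        by apply: open_nbhs_nbhs; split => //; exists y.
      have := chart_inv_continuous cc cy; rewrite yu; apply.
      by apply: open_nbhs_nbhs.
    move=> u; rewrite inE imE => -[[y cy <-] /=]; rewrite cK // => Vy.
    apply: continuous_comp; first exact: (chart_inv_continuous cc).
    by rewrite cK //; apply: sc.
exists e; split => //; last by move=> z [].
by split => //; exists c; split => // z [].
Qed.

(** Charts upstairs factor through [p], so their transition maps agree near each point with
    transition maps of [A]. Hausdorffness and second countability are not local and are supplied
    separately for each total space. *)
Lemma pullback_atlas_manifold : hausdorff_space T -> @second_countable T ->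
  is_manifold (@differentiable_on K) (pullback_atlas p A).
Proof.
move=> hT scT.
have compat c' d' : pullback_atlas p A c' -> pullback_atlas p A d' ->
    differentiable_on (c' @` (chart_dom c' `&` chart_dom d'))
      (d' \o chart_inv c').
  move=> [c'c [c [cA c'p c'E]]] [d'c [d [dA d'p d'E]]] _ [x [c'x d'x] <-].
  have cx := c'p _ c'x; have dx := d'p _ d'x.
  have [+ _] := atlas_compatible aA cA dA.
  move=> /(_ (c (p x))) h.
  have {}h : differentiable (d \o chart_inv c) (c (p x)) by apply: h; exists (p x).
  rewrite c'E //; apply: (proj1 (differentiable_near _ h)).
  have := chart_inv_near c'c c'x (chart_dom_near d'c d'x); rewrite c'E //.
  apply: filterS => u [c'u uE d'u] /=.
  rewrite -[X in chart_inv c X]uE d'E // c'E //.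
  rewrite (chart_invK (atlas_chart aA cA)) //.
  exact: c'p.
split=> //.
- by move=> c [].
- move=> x; have [c cA cx] := atlas_cover aA (p x).
  by have [e [eA ex _ _]] := pullback_chart cA cx; exists e.
- by move=> c d cA dA; split; [|rewrite setIC]; exact: compat.
Qed.

Lemma pullback_atlas_pulled_back : hausdorff_space T -> @second_countable T ->
  pulled_back p (pullback_atlas p A) A.
Proof.
move=> hT scT c c' cA c'A.
exact: (atlas_compatible (manifold_atlas (pullback_atlas_manifold hT scT))).
Qed.

Variable A' : set (chart K T n).
Hypothesis aA' : is_atlas A'.
Hypothesis pbA : pulled_back p A' A.

Lemma pulled_back_hol x : hol_at A' A p x.
Proof.
split; first by case: lp => + _; apply.
move=> c' c c'A cA c'x cx; have [e [eA ex eE _]] := pullback_chart cA cx.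
by have [+ _] := pbA c'A eA; rewrite /differentiable_on eE; apply; exists x.
Qed.

Variables (X : topologicalType) (k : nat) (C : set (chart K X k)).
Hypothesis Cc : forall c, C c -> is_chart c.

(** In a pullback chart [e = c0 \o p] the map [f] reads as [p \o f] in [c0], and passing from [e] to
    a chart of [A'] is holomorphic. Holomorphy of a lifted map is thereby reduced to its
    continuity. *)
Lemma hol_at_lift (f : X -> T) x : {for x, continuous f} ->
  hol_at C A (p \o f) x -> hol_at C A' f x.
Proof.
move=> fc [_ fd]; split => // c c' cC c'A cx c'x.
have [c0 c0A c0x] := atlas_cover aA (p (f x)).
have [e [eA ex eE _]] := pullback_chart c0A c0x.
have h1 := fd c c0 cC c0A cx c0x.
have h2 : differentiable (c' \o chart_inv e) (e (f x)).
  by have [_ +] := pbA c'A eA; apply; exists (f x).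
have h : differentiable
    ((c' \o chart_inv e) \o (c0 \o (p \o f) \o chart_inv c)) (c x).
  apply: differentiable_comp => //=.
  by rewrite (chart_invK (Cc cC)) // -[c0 _]/((c0 \o p) _) -eE.
apply: (proj1 (differentiable_near _ h)).
have ec : is_chart e by case: eA.
have fe : nbhs x (f @^-1` chart_dom e) by apply: fc; apply: chart_dom_near.
have := chart_inv_near (Cc cC) cx fe.
apply: filterS => u [_ _ /= eu].
by rewrite -[c0 _]/((c0 \o p) _) -eE (chart_invK ec).
Qed.

(** In the pullback chart [f] has the differential of [p \o f]; the change to a chart of [A'] keeps
    it onto by [diff_surj_comp]. *)
Lemma submersion_at_lift (f : X -> T) x : {for x, continuous f} ->
  submersion_at C A (p \o f) x -> submersion_at C A' f x.
Proof.
move=> fc fd c c' cC c'A cx c'x g.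
have [c0 c0A c0x] := atlas_cover aA (p (f x)).
have [e [eA ex eE _]] := pullback_chart c0A c0x.
have [h1 s1] := fd c c0 cC c0A cx c0x.
have [h2 h2'] : differentiable (c' \o chart_inv e) (e (f x)) /\
    differentiable (e \o chart_inv c') (c' (f x)).
  by have [a b] := pbA c'A eA; split; [apply: b|apply: a]; exists (f x).
have ec : is_chart e by case: eA.
have c'c := atlas_chart aA' c'A.
have eE' z : c0 (p z) = e z by rewrite eE.
set h := c0 \o (p \o f) \o chart_inv c in h1 s1.
have hx : h (c x) = e (f x) by rewrite /h /= (chart_invK (Cc cC)).
have fE : chart_inv c' (c' (f x)) = f x by rewrite (chart_invK c'c).
have tE : chart_inv e (h (c x)) = f x by rewrite hx (chart_invK ec).
apply: (@diff_surj_comp _ _ _ _ h (c' \o chart_inv e) (e \o chart_inv c')) => //.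
- by rewrite hx.
- by rewrite /= tE.
- by rewrite /= tE fE hx.
- rewrite /= tE; have := chart_inv_near c'c c'x (chart_dom_near ec ex).
  by apply: filterS => u [_ u1 u2] /=; rewrite (chart_invK ec).
- have fe : nbhs x (f @^-1` chart_dom e) by apply: fc; apply: chart_dom_near.
  have := chart_inv_near (Cc cC) cx fe.
  apply: filterS => u [_ _ /= eu].
  by rewrite /h /g /= eE' (chart_invK ec).
Qed.

End PullbackAtlas.

(** * Path and homotopy lifting *)

Section PathLifting.
Variable R : realType.

(** The step hypothesis is symmetric in [s] and [s'], so [P] is locally constant on [0, 1]: its
    truth set there is open and closed, and [0, 1] is connected. *)
Lemma unit_interval_induction (P : R -> Prop) : P 0 ->
  (forall t : R, 0 <= t <= 1 -> exists2 N : set R, nbhs t N &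
    forall s s', N s -> N s' ->
    0 <= s <= 1 -> 0 <= s' <= 1 -> P s -> P s') ->
  forall t : R, 0 <= t <= 1 -> P t.
Proof.
move=> P0 PN t t01.
pose I : set R := [set` `[0%R, 1%R]].
have IE s : I s = (0 <= s <= 1) :> Prop by rewrite /I /= in_itv.
suff : (I `&` P) t by case.
have cI : connected I by exact: segment_connected.
have -> : I `&` P = I; last by rewrite IE.
apply: cI.
- by exists 0; split => //; rewrite IE lexx ler01.
- exists (interior [set s | I s -> P s]); first exact: open_interior.
  apply/seteqP; split=> s [Is]; last by move/interior_subset; split => //; auto.
  move=> Ps; split => //; have Is' := Is; rewrite IE in Is'.
  have [N Ns NP] := PN s Is'; apply: filterS (Ns) => s' Ns' Is''.
  have {}Is'' : 0 <= s' <= 1 by rewrite -IE.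
  by apply: NP (nbhs_singleton Ns) Ns' _ _ Ps.
- exists (~` interior [set s | I s -> ~ P s]).
    by apply: open_closedC; exact: open_interior.
  apply/seteqP; split=> s [Is]; last first.
    move=> nP; split => //; apply: contrapT => Ps; apply: nP.
    have Is' := Is; rewrite IE in Is'.
    have [N Ns NP] := PN s Is'; apply: filterS (Ns) => s' Ns' Is''.
    move=> Ps'; apply: Ps; have {}Is'' : 0 <= s' <= 1 by rewrite -IE.
    by apply: NP Ns' (nbhs_singleton Ns) _ _ Ps'.
  by move=> Ps; split => // /interior_subset /(_ Is).
Qed.

Lemma lift_eq_near (X T S : topologicalType) (p : T -> S) (u v : X -> T) x :
  local_homeo p -> {for x, continuous u} -> {for x, continuous v} ->
  u x = v x -> \forall y \near x, p (u y) = p (v y) -> u y = v y.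
Proof.
move=> [pc /(_ (u x))[V [B [s [[oV oB _ sK _] Bx]]]]] uc vc uv.
have uB : nbhs x (u @^-1` B) by apply: uc; exact: open_nbhs_nbhs.
have vB : nbhs x (v @^-1` B) by apply: vc; rewrite -uv; exact: open_nbhs_nbhs.
apply: filterS2 uB vB => y uB vB puv.
by have [_ <-] := sK _ uB; have [_ <-] := sK _ vB; rewrite puv.
Qed.

Lemma hausdorff_neq_near (X T : topologicalType) (u v : X -> T) x :
  hausdorff_space T -> {for x, continuous u} -> {for x, continuous v} ->
  u x <> v x -> \forall y \near x, u y <> v y.
Proof.
rewrite open_hausdorff => hT uc vc /eqP /hT[[A B] /=].
rewrite !inE => -[uA vB] [oA oB AB].
have uA' : nbhs x (u @^-1` A) by apply: uc; exact: open_nbhs_nbhs.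
have vB' : nbhs x (v @^-1` B) by apply: vc; exact: open_nbhs_nbhs.
apply: filterS2 uA' vB' => y /= Ay By uv.
have : (A `&` B) (u y) by split; rewrite // uv.
by rewrite AB.
Qed.

Variables (T S : topologicalType) (p : T -> S).
Hypothesis hT : hausdorff_space T.

(** Agreement of [u] and [v] propagates to nearby times because [p] is injective on sheets,
    disagreement because [T] is Hausdorff. *)
Lemma path_lift_unique (u v : R -> T) : local_homeo p ->
  (forall t : R, 0 <= t <= 1 -> {for t, continuous u}) ->
  (forall t : R, 0 <= t <= 1 -> {for t, continuous v}) ->
  (forall t : R, 0 <= t <= 1 -> p (u t) = p (v t)) -> u 0 = v 0 ->
  forall t : R, 0 <= t <= 1 -> u t = v t.
Proof.
move=> lp uc vc puv uv0; apply: (unit_interval_induction uv0) => t t01.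
have [uvt|uvt] := pselect (u t = v t).
  exists [set y | p (u y) = p (v y) -> u y = v y].
    exact: (lift_eq_near lp (uc t t01) (vc t t01) uvt).
  by move=> s s' _ /= Ns' _ s'01 _; apply: Ns'; exact: puv.
exists [set y | u y <> v y] => [|s s' /=//].
exact: (hausdorff_neq_near hT (uc t t01) (vc t t01) uvt).
Qed.

(** For the time where two partial lifts meet: the glued map takes one of two values at each point,
    and both candidates are continuous at [x] with the same value. *)
Lemma glue_continuous (X Z : topologicalType) (u v w : X -> Z) x :
  {for x, continuous u} -> {for x, continuous v} -> u x = v x ->
  (forall y, w y = u y \/ w y = v y) -> {for x, continuous w}.
Proof.
move=> uc vc uv wuv W Wx.
have wx : w x = u x by have [|->] := wuv x.
rewrite wx in Wx.
have uW : nbhs x (u @^-1` W) by exact: uc.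
have vW : nbhs x (v @^-1` W) by apply: vc; rewrite -uv.
change (nbhs x (w @^-1` W)).
by apply: filterS2 uW vW => y /= ? ?; have [->|->] := wuv y.
Qed.

Lemma continuous_at_near (X Z : topologicalType) (u v : X -> Z) x :
  (\forall y \near x, u y = v y) -> {for x, continuous u} ->
  {for x, continuous v}.
Proof.
move=> uv uc; change (v @ x --> v x); rewrite -(nbhs_singleton uv).
by apply: cvg_trans uc; apply: near_eq_cvg.
Qed.

Lemma slice_continuous (X Z : topologicalType) (u : R * X -> Z) t x :
  {for (t, x), continuous u} ->
  {for t, continuous (fun s => u (s, x))} /\
  {for x, continuous (fun y => u (t, y))}.
Proof.
move=> uc; split.
  apply: (@continuous_comp _ _ _ (fun s => (s, x)) u) => //.
  by apply: continuous_pair_at; [exact: cvg_id|exact: cst_continuous].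
apply: (@continuous_comp _ _ _ (fun y => (t, y)) u) => //.
by apply: continuous_pair_at; [exact: cst_continuous|exact: cvg_id].
Qed.

(** Retraction of the line onto [0, 1]. Composing with it extends homotopies to all real times, so
    that continuity can be stated at points of [R] without subspace topologies. *)
Definition clamp (t : R) : R := Num.max 0 (Num.min t 1).

Lemma clamp01 t : 0 <= clamp t <= 1.
Proof. by rewrite /clamp le_max lexx ge_max ler01 ge_min lexx orbT. Qed.

Lemma clamp_id t : 0 <= t <= 1 -> clamp t = t.
Proof. by move=> /andP[t0 t1]; rewrite /clamp (min_idPl t1) (max_idPr t0). Qed.

Lemma clamp_continuous : continuous clamp.
Proof.
move=> t; apply: (@continuous_comp _ _ _ (fun s : R => (0 : R, Num.min s 1))
  (fun z : R * R => Num.max z.1 z.2)); last exact: max_continuous.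
apply: continuous_pair_at; first exact: cst_continuous.
apply: (@continuous_comp _ _ _ (fun s : R => (s, 1 : R))
  (fun z : R * R => Num.min z.1 z.2)); last exact: min_continuous.
by apply: continuous_pair_at; [exact: cvg_id|exact: cst_continuous].
Qed.

Hypothesis cp : covering_map p.
Variables (X : topologicalType) (f : R * X -> S) (D : set X) (f0 : X -> T).
Hypothesis oD : open D.
Hypothesis fc : forall (t : R) x,
  0 <= t <= 1 -> D x -> {for (t, x), continuous f}.
Hypothesis f0c : forall x, D x -> {for x, continuous f0}.
Hypothesis pf0 : forall x, D x -> p (f0 x) = f (0, x).

(** All parameters near [x0] are lifted together up to time [s]; the neighbourhood [N] may shrink as
    [s] grows. *)
Let partial_lift (x0 : X) (s : R) : Prop := exists (N : set X) (F : R * X -> T),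
  [/\ open_nbhs x0 N, N `<=` D, (forall x, N x -> F (0, x) = f0 x) &
    forall (t : R) x, 0 <= t <= s -> N x ->
      {for (t, x), continuous F} /\ p (F (t, x)) = f (t, x)].

(** Near [(t, x0)] the map [f] takes values in one evenly covered [V]. For [s < s'] close to [t],
    the lift up to [s] is continued to [s'] inside the sheet that contains [F (s, x0)]; going back
    to a smaller time is restriction. *)
Let lift_unit x0 : D x0 -> partial_lift x0 1.
Proof.
move=> Dx0.
apply: (@unit_interval_induction (partial_lift x0)); last by rewrite ler01 lexx.
  exists D, (f0 \o snd); split=> // t x /andP[t0 t0'] Dx.
  have -> : t = 0 by apply/eqP; rewrite eq_le t0 t0'.
  split; last exact: pf0.
  by apply: continuous_comp; [exact: continuous_snd|exact: f0c].
move=> t t01; case: (cp) => pc _ /(_ (f (t, x0)))[V [oV Vt] eV].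
have : nbhs (t, x0) (f @^-1` V) by apply: fc => //; exact: open_nbhs_nbhs.
move=> [[Q N1] [/= Qt N1x0] QN].
have [e /= e0 eQ] : exists2 e : R, 0 < e & ball t e `<=` Q.
  by apply/nbhs_ballP.
exists (ball t e); first exact: nbhsx_ballx.
move=> s s' st s't s01 s'01 [N [F [Nx0 ND F0 FN]]].
have [s's|ss'] := leP s' s.
  exists N, F; split => // r x /andP[r0 rs] Nx; apply: FN => //.
  by rewrite r0 (le_trans rs).
have [s0 s1] := andP s01; have [s'0 s'1] := andP s'01.
have fV r x : s <= r <= s' -> N1 x -> V (f (r, x)).
  move=> /andP[sr rs'] N1x; apply: (QN (r, x)); split => //=; apply: eQ.
  move: st s't; rewrite /ball /= !ltr_distl => /andP[a b] /andP[c d].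
  by rewrite (le_lt_trans _ c) ?lerD2r // (lt_le_trans b) ?lerD2r.
have Nx0' : N x0 by case: Nx0.
have ssI r : s <= r <= s' -> 0 <= r <= 1.
  by move=> /andP[a b]; rewrite (le_trans s0 a) (le_trans b s'1).
have [Fc pF] := FN s x0 (introT andP (conj s0 (lexx s))) Nx0'.
have N1x0' := nbhs_singleton N1x0.
have VF : V (p (F (s, x0))) by rewrite pF; apply: fV => //; rewrite lexx ltW.
have [B [sg [[_ oB sP sK sc] BF]]] := evenly_covered_sheet oV eV VF.
have Bn : nbhs x0 (fun x => B (F (s, x))).
  by apply: (proj2 (slice_continuous Fc)); exact: open_nbhs_nbhs.
have : nbhs x0 (N `&` N1 `&` (fun x => B (F (s, x)))).
  by apply: filterI => //; apply: filterI => //; exact: open_nbhs_nbhs.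
rewrite nbhsE => -[N' N'x0 N'N].
(* [N'] is small enough for [F (s, x)] to remain in the sheet [B], so [F] and [sg \o f] match at
   time [s]. *)
pose F' z := if z.1 < s then F z else sg (f z).
exists N', F'; split => //.
- by move=> x /N'N [[/ND]].
- move=> x /N'N[[Nx N1x] BFx]; rewrite /F' /=; case: ltP => [_|s0'].
    exact: F0.
  (* For [s = 0] the initial value is already produced by [sg]; it is the prescribed one since
     [F (0, x)] lies in [B]. *)
  have sE : s = 0 by apply/eqP; rewrite eq_le s0 s0'.
  rewrite -(F0 _ Nx) -{1}sE -(proj2 (FN s x _ Nx)) ?s0 ?lexx //.
  by rewrite sE in BFx *; have [_ ->] := sK _ BFx.
- move=> r x /andP[r0 rs'] /N'N[[Nx N1x] BFx].
  have Dx := ND _ Nx.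
  have [rs|sr|rs] := ltgtP r s.
  + have [Fcr pFr] := FN r x (introT andP (conj r0 (ltW rs))) Nx.
    split; last by rewrite /F' /= rs.
    apply: continuous_at_near Fcr.
    have : nbhs (r, x) (fst @^-1` [set q : R | q < s]).
      by apply: continuous_fst; exact: lt_nbhsl.
    by apply: filterS => z /= zs; rewrite /F' zs.
  + have r01 : 0 <= r <= 1 by apply: ssI; rewrite ltW.
    have Vr : V (f (r, x)) by apply: fV => //; rewrite ltW.
    split; last by rewrite /F' /= ltNge ltW //=; exact: (proj2 (sP _ Vr)).
    apply: (@continuous_at_near _ _ (sg \o f)).
      have : nbhs (r, x) (fst @^-1` [set q : R | s < q]).
        by apply: continuous_fst; exact: lt_nbhsr.
      by apply: filterS => z /= zs; rewrite /F' ltNge ltW.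
    by apply: continuous_comp; [exact: fc|exact: sc].
  + rewrite rs in r0 rs' *.
    have Vr : V (f (s, x)) by apply: fV => //; rewrite lexx.
    have [Fcr pFr] := FN s x (introT andP (conj s0 (lexx s))) Nx.
    split; last by rewrite /F' /= ltxx; exact: (proj2 (sP _ Vr)).
    apply: (@glue_continuous _ _ F (sg \o f)) => //.
    * by apply: continuous_comp; [exact: fc|exact: sc].
    * by rewrite /= -pFr; have [_ ->] := sK _ BFx.
    * by move=> z; rewrite /F'; case: ifP; [left|right].
Qed.

(** [F] uses at each [x] the local lift chosen for that very [x]. On a neighbourhood of a fixed
    point these choices agree with a single continuous lift, by uniqueness of path lifts, which
    gives joint continuity. Times are clamped, hence continuity for all [t] but the lifting equation
    on [0, 1] only. *)
Lemma homotopy_lifting : exists F : R * X -> T,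
  [/\ (forall (t : R) x, D x -> {for (t, x), continuous F}),
      (forall x, D x -> F (0, x) = f0 x) &
      forall (t : R) x, 0 <= t <= 1 -> D x -> p (F (t, x)) = f (t, x)].
Proof.
have /choice[L LP] x : exists G : R * X -> T, D x -> exists N : set X,
    [/\ open_nbhs x N, N `<=` D, (forall y, N y -> G (0, y) = f0 y) &
      forall (t : R) y, 0 <= t <= 1 -> N y ->
        {for (t, y), continuous G} /\ p (G (t, y)) = f (t, y)].
  have [Dx|nDx] := pselect (D x); last by exists (f0 \o snd).
  by have [N [G]] := lift_unit Dx; exists G => _; exists N.
pose F z := L z.2 (clamp z.1, z.2).
have FE x0 : D x0 -> exists (N : set X) (G : R * X -> T), [/\ open_nbhs x0 N,
    N `<=` D, (forall x, N x -> G (0, x) = f0 x),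
    (forall (t : R) x, 0 <= t <= 1 -> N x ->
      {for (t, x), continuous G} /\ p (G (t, x)) = f (t, x)) &
    forall t : R, F (t, x0) = G (clamp t, x0)].
  by move=> /LP[N [? ? ? ?]]; exists N, (L x0).
have lp := covering_local_homeo cp.
have FE' x0 : D x0 -> exists (N : set X) (G : R * X -> T), [/\ open_nbhs x0 N,
    (forall (t : R) x, 0 <= t <= 1 -> N x -> {for (t, x), continuous G}) &
    forall (t : R) x, N x -> F (t, x) = G (clamp t, x)].
  move=> /FE[N [G [Nx0 ND G0 GN _]]]; exists N, G; split => //.
    by move=> t x t01 Nx; have [] := GN t x t01 Nx.
  move=> t x Nx; have [N' [G' [N'x _ G'0 G'N ->]]] := FE _ (ND _ Nx).
  have {N'x} N'x : N' x by case: N'x.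
  apply: (@path_lift_unique (fun t => G' (t, x)) (fun t => G (t, x)) lp).
  - by move=> r r01; have [/slice_continuous[]] := G'N r x r01 N'x.
  - by move=> r r01; have [/slice_continuous[]] := GN r x r01 Nx.
  - by move=> r r01; have [_ ->] := G'N r x r01 N'x; have [_ ->] := GN r x r01 Nx.
  - by rewrite G'0 // G0.
  - exact: clamp01.
exists F; split.
- move=> t x /FE'[N [G [[oN Nx] GN FG]]].
  apply: (@continuous_at_near _ _ (fun z => G (clamp z.1, z.2))).
    have : nbhs (t, x) (snd @^-1` N).
      by apply: continuous_snd; exact: open_nbhs_nbhs.
    by apply: filterS => -[r y] /= Ny; rewrite FG.
  apply: (@continuous_comp _ _ _ (fun z => (clamp z.1, z.2)) G).
    apply: (@continuous_pair_at _ _ _ (clamp \o fst) snd); last exact: continuous_snd.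
    by apply: continuous_comp; [exact: continuous_fst|exact: clamp_continuous].
  by apply: GN => //; exact: clamp01.
- move=> x /FE[N [G [[_ Nx] ND G0 GN ->]]].
  by rewrite clamp_id ?G0 // lexx ler01.
- move=> t x t01 /FE[N [G [[_ Nx] ND G0 GN ->]]].
  by rewrite clamp_id //; have [] := GN t x t01 Nx.
Qed.

End PathLifting.

(** * Pullback of bundles and sprays *)

Section TopologyFacts.

Lemma hausdorff_inj (T S : topologicalType) (f : T -> S) :
  continuous f -> injective f -> hausdorff_space S -> hausdorff_space T.
Proof.
move=> fc finj; rewrite !open_hausdorff => hS x y xy.
have /hS[[A B] /=] : f x != f y by apply: contra_neq xy => /finj.
rewrite !inE => -[fxA fyB] [oA oB AB].
exists (f @^-1` A, f @^-1` B); first by rewrite !inE.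
split; do ?[by apply: open_comp].
by rewrite -preimage_setI AB preimage_set0.
Qed.

Lemma hausdorff_prod (T S : topologicalType) :
  hausdorff_space T -> hausdorff_space S -> hausdorff_space (T * S)%type.
Proof.
rewrite !open_hausdorff => hT hS [x y] [x' y'].
rewrite xpair_eqE negb_and => /orP[/hT|/hS] [[A B] /=].
  rewrite !inE => -[xA x'B] [oA oB AB].
  exists (fst @^-1` A, fst @^-1` B); rewrite ?inE //; split.
  - by apply: open_comp => // z _; exact: continuous_fst.
  - by apply: open_comp => // z _; exact: continuous_fst.
  - by rewrite /= -preimage_setI AB preimage_set0.
rewrite !inE => -[xA x'B] [oA oB AB].
exists (snd @^-1` A, snd @^-1` B); rewrite ?inE //; split.
- by apply: open_comp => // z _; exact: continuous_snd.
- by apply: open_comp => // z _; exact: continuous_snd.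
- by rewrite /= -preimage_setI AB preimage_set0.
Qed.

Lemma second_countable_prod (T S : topologicalType) :
  @second_countable T -> @second_countable S -> @second_countable (T * S)%type.
Proof.
move=> [B cB [Bo Bb]] [C cC [Co Cb]].
exists [set U.1 `*` U.2 | U in B `*` C].
  by apply: sub_countable (card_image_le _ _) _; exact: countableX.
split.
  move=> _ [[U V] [/= UB VC] <-].
  rewrite (_ : _ `*` _ = (fst @^-1` U) `&` (snd @^-1` V)) //.
  apply: openI; apply: open_comp; do ?[by auto]; move=> z _;
    [exact: continuous_fst|exact: continuous_snd].
move=> [x y] W [[/= P Q] [Px Qy] PQW].
have [U [UB Ux] UP] := Bb x _ Px; have [V [VC Vy] VQ] := Cb y _ Qy.
exists (U `*` V); first by split => //; exists (U, V).
by move=> [a b] [/= Ua Vb]; apply: PQW; split; [exact: UP|exact: VQ].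
Qed.

Lemma set_val_continuous (T : topologicalType) (A : set T) :
  continuous (\val : A -> T).
Proof. exact: initial_continuous. Qed.

Lemma continuous_to_set_type (X T : topologicalType) (A : set T) (f : X -> A) x :
  {for x, continuous (\val \o f)} -> {for x, continuous f}.
Proof.
move=> fc W [_ [[V oV <-] Vfx] VW].
change (nbhs x (f @^-1` W)).
have : nbhs x ((\val \o f) @^-1` V) by apply: fc; exact: open_nbhs_nbhs.
by apply: filterS => y Vy; apply: VW.
Qed.

Lemma second_countable_set_type (T : topologicalType) (A : set T) :
  @second_countable T -> @second_countable A.
Proof.
move=> [B cB [Bo Bb]]; exists [set (\val : A -> T) @^-1` U | U in B].
  by apply: sub_countable (card_image_le _ _) _.
split; first by move=> _ [U UB <-]; exists U => //; exact: Bo.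
move=> x W [_ [[V oV <-] Vx] VW].
have [|U [UB Ux] UV] := Bb (\val x) V; first exact: open_nbhs_nbhs.
exists ((\val : A -> T) @^-1` U); first by split => //; exists U.
by move=> y Uy; apply: VW; exact: UV.
Qed.

End TopologyFacts.

Section VectorBundles.
Variables (K : numFieldType) (n r : nat) (Y : holManifold K n).
Variable E : vectorBundle Y r.

Let aY := manifold_atlas (atlasP Y).
Let aE := manifold_atlas (atlasP E).

(** Pointwise form of local triviality with the inverse [g] made explicit; identities in [E] are
    checked through [tau] and brought back by [g]. *)
Lemma vb_trivialization (y0 : Y) : exists (U : set Y) (tau : E -> 'rV[K]_r)
    (g : Y * 'rV[K]_r -> E),
  [/\ open_nbhs y0 U,
    (forall e, U (vb_proj e) ->
      [/\ g (vb_proj e, tau e) = e,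
        hol_at (atlas E) (atlas Y) (@vb_proj _ _ _ _ E) e &
        hol_at (atlas E) (model_atlas K r) tau e]),
    (forall y v, U y -> [/\ vb_proj (g (y, v)) = y, tau (g (y, v)) = v &
        hol_at (prod_atlas (atlas Y) (model_atlas K r)) (atlas E) g (y, v)]) &
    [/\ (forall y, U y -> tau (vb_zero E y) = 0),
       (forall e e', U (vb_proj e) -> vb_proj e = vb_proj e' ->
         tau (vb_add e e') = tau e + tau e') &
       (forall a e, U (vb_proj e) -> tau (vb_scale a e) = a *: tau e)]].
Proof.
have [U [tau [Uy0 [g [fg gf hf hg]] t0 tD tZ]]] := vb_locally_trivial E y0.
exists U, tau, g; split => // [e Ue|y v Uy].
  have [_ ge] := fg e Ue; have he := (holomorphic_onP _ _ _ _).1 hf e Ue.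
  split => //.
    exact: (hol_at_comp (atlas_chart aE) (prod_is_chart aY (model_is_atlas K r))
      (prod_atlas_cover aY (model_is_atlas K r)) he
      (hol_at_fst (model_atlas K r) aY _)).
  exact: (hol_at_comp (atlas_chart aE) (prod_is_chart aY (model_is_atlas K r))
    (prod_atlas_cover aY (model_is_atlas K r)) he
    (hol_at_snd (atlas Y) (model_is_atlas K r) _)).
have [_ [gy gv]] := gf (y, v) (conj Uy I); split => //.
exact: ((holomorphic_onP _ _ _ _).1 hg).
Qed.

Lemma vb_proj_hol e : hol_at (atlas E) (atlas Y) (@vb_proj _ _ _ _ E) e.
Proof.
have [U [tau [g [[_ Uy] tE _ _]]]] := vb_trivialization (vb_proj e).
by have [] := tE e Uy.
Qed.

Lemma vb_proj_continuous : continuous (@vb_proj _ _ _ _ E).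
Proof. by move=> e; have [] := vb_proj_hol e. Qed.

Lemma vb_scale_continuous (X : topologicalType) (c : X -> K) (f : X -> E) x :
  {for x, continuous c} -> {for x, continuous f} ->
  {for x, continuous (fun z => vb_scale (c z) (f z))}.
Proof.
move=> cc fc.
have [U [tau [g [[oU Uy] tE gE [_ _ tZ]]]]] := vb_trivialization (vb_proj (f x)).
apply: (@continuous_at_near _ _
    (fun z => g (vb_proj (f z), c z *: tau (f z)))).
  have : nbhs x ((@vb_proj _ _ _ _ E \o f) @^-1` U).
    apply: (continuous_comp fc (@vb_proj_continuous (f x))).
    exact: open_nbhs_nbhs.
  apply: filterS => z /= Uz.
  have Uz' : U (vb_proj (vb_scale (c z) (f z))) by rewrite vb_proj_scale.
  by have [<- _ _] := tE _ Uz'; rewrite tZ // vb_proj_scale.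
have [_ _ [gc _]] := gE (vb_proj (f x)) (c x *: tau (f x)) Uy.
apply: (@continuous_comp _ _ _ (fun z => (vb_proj (f z), c z *: tau (f z))) g) => //.
apply: continuous_pair_at.
  exact: (continuous_comp fc (@vb_proj_continuous (f x))).
apply: cvgZ => //.
have [_ _ [tc _]] := tE _ Uy.
exact: (continuous_comp fc tc).
Qed.

Lemma vb_scale1 (e : E) : vb_scale 1 e = e.
Proof.
have [U [tau [g [[oU Uy] tE gE [_ _ tZ]]]]] := vb_trivialization (vb_proj e).
have [|<- _ _] := tE (vb_scale 1 e); first by rewrite vb_proj_scale.
by rewrite vb_proj_scale tZ // scale1r; have [] := tE e Uy.
Qed.

Lemma vb_scale0 (e : E) : vb_scale 0 e = vb_zero E (vb_proj e).
Proof.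
have [U [tau [g [[oU Uy] tE gE [t0 _ tZ]]]]] := vb_trivialization (vb_proj e).
have [|<- _ _] := tE (vb_scale 0 e); first by rewrite vb_proj_scale.
have [|<- _ _] := tE (vb_zero E (vb_proj e)); first by rewrite vb_proj_zero.
by rewrite vb_proj_scale vb_proj_zero tZ // scale0r t0.
Qed.

Lemma vb_scale_zero (a : K) y : vb_scale a (vb_zero E y) = vb_zero E y.
Proof.
have [U [tau [g [[oU Uy] tE gE [t0 _ tZ]]]]] := vb_trivialization y.
have [|h1 _ _] := tE (vb_scale a (vb_zero E y)).
  by rewrite vb_proj_scale vb_proj_zero.
have [|h2 _ _] := tE (vb_zero E y); first by rewrite vb_proj_zero.
rewrite -h1 -[RHS]h2 vb_proj_scale tZ ?vb_proj_zero //.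
by rewrite t0 // scaler0.
Qed.

(** In a trivialization the frame is a linear self-map of K^r, hence continuous. Domination is
    tested on arbitrary frames, and lifting a submersion requires a continuous map. *)
Lemma fiber_frame_continuous y (psi : 'rV[K]_r -> E) :
  fiber_frame y psi -> continuous psi.
Proof.
move=> [[psiy _ _] psil].
have {}psiy v : vb_proj (psi v) = y by exact: psiy.
have [U [tau [g [[oU Uy] tE gE [_ tD tZ]]]]] := vb_trivialization y.
have tl : linear (tau \o psi).
  move=> a u v /=; rewrite psil tD ?vb_proj_scale ?psiy //.
  by rewrite tZ ?psiy.
pose L : {linear 'rV[K]_r -> 'rV[K]_r} :=
  HB.pack (tau \o psi) (GRing.isLinear.Build _ _ _ _ _ tl).
have psiE : psi = g \o (fun v => (y, L v)).
  apply/funext => v /=; have [|] := tE (psi v); first by rewrite psiy.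
  by rewrite psiy.
move=> v; rewrite psiE; apply: continuous_comp.
  apply: continuous_pair_at; first exact: cst_continuous.
  by apply: differentiable_continuous; exact: rV_linear_differentiable.
by have [_ _ []] := gE y (L v) Uy.
Qed.

End VectorBundles.

(** * The pulled back bundle p^*E *)

Section PullbackBundle.
Variables (K : numFieldType) (n r : nat) (Y Y' : holManifold K n).
Variables (p : Y' -> Y) (covp : manifold_covering p) (E : vectorBundle Y r).

Let aY := manifold_atlas (atlasP Y).
Let aY' := manifold_atlas (atlasP Y').
Let aE := manifold_atlas (atlasP E).
Let lp : local_homeo p.
Proof. by apply: covering_local_homeo; case: covp. Qed.
Let pc : continuous p. Proof. by case: lp. Qed.
Let pbY : pulled_back p (atlas Y') (atlas Y). Proof. by case: covp. Qed.

Definition pb_set : set (Y' * E) := [set z | p z.1 = vb_proj z.2].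
Definition pb_space : topologicalType := set_type pb_set.

Definition pb_val (z : pb_space) : Y' * E := sval z.
Definition pb1 (z : pb_space) : Y' := (pb_val z).1.
Definition pb2 (z : pb_space) : E := (pb_val z).2.

Lemma pb_val_inj : injective pb_val.
Proof. exact: val_inj. Qed.

Lemma pb_val_continuous : continuous pb_val.
Proof. exact: (@set_val_continuous _ pb_set). Qed.

Lemma pb_eq z : p (pb1 z) = vb_proj (pb2 z).
Proof. by case: z => z zP; exact: (set_mem zP). Qed.

Lemma pb_inj z z' : pb1 z = pb1 z' -> pb2 z = pb2 z' -> z = z'.
Proof.
move=> h1 h2; apply: pb_val_inj.
rewrite (surjective_pairing (pb_val z)) (surjective_pairing (pb_val z')).
by congr (_, _).
Qed.

(* [d] is a junk value, returned when [y] and [e] do not lie over the same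
   point of [Y]. *)
Definition pb_mk (d : pb_space) (y : Y') (e : E) : pb_space :=
  if pselect (p y = vb_proj e) is left h then
    exist _ (y, e) (@mem_set _ pb_set (y, e) h)
  else d.

Lemma pb_mk1 d y e : p y = vb_proj e -> pb1 (pb_mk d y e) = y.
Proof. by rewrite /pb_mk; case: pselect. Qed.

Lemma pb_mk2 d y e : p y = vb_proj e -> pb2 (pb_mk d y e) = e.
Proof. by rewrite /pb_mk; case: pselect. Qed.

Lemma pb1_continuous : continuous pb1.
Proof.
move=> z; apply: (@continuous_comp _ _ _ pb_val fst).
  exact: pb_val_continuous.
exact: continuous_fst.
Qed.

Lemma pb2_continuous : continuous pb2.
Proof.
move=> z; apply: (@continuous_comp _ _ _ pb_val snd).
  exact: pb_val_continuous.
exact: continuous_snd.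
Qed.

Lemma pb_continuous (X : topologicalType) (f : X -> pb_space) x :
  {for x, continuous (pb1 \o f)} -> {for x, continuous (pb2 \o f)} ->
  {for x, continuous f}.
Proof.
move=> h1 h2; apply: (@continuous_to_set_type _ _ pb_set).
change {for x, continuous (pb_val \o f)}.
have -> : pb_val \o f = (fun z => ((pb1 \o f) z, (pb2 \o f) z)).
  by apply/funext => z /=; rewrite -surjective_pairing.
exact: continuous_pair_at.
Qed.

(** Base change of [p] along the bundle projection: a sheet over [V] with section [s] gives a sheet
    over the preimage of [V], whose section sends [e] to [(s (vb_proj e), e)]. *)
Lemma pb2_local_homeo : local_homeo pb2.
Proof.
split=> [|z]; first exact: pb2_continuous.
have [_ /(_ (pb1 z))[V [B [s [[oV oB sP sK sc] Bz]]]]] := lp.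
pose s' e := pb_mk z (s (vb_proj e)) e.
have s1 e : V (vb_proj e) -> pb1 (s' e) = s (vb_proj e).
  by move=> Ve; rewrite pb_mk1 //; have [] := sP _ Ve.
have s2 e : V (vb_proj e) -> pb2 (s' e) = e.
  by move=> Ve; rewrite pb_mk2 //; have [] := sP _ Ve.
have pE := @vb_proj_continuous _ _ _ _ E.
have oVE : open (@vb_proj _ _ _ _ E @^-1` V) by apply: open_comp.
exists (@vb_proj _ _ _ _ E @^-1` V), (pb1 @^-1` B), s'; split => //; split => //.
- by apply: open_comp => // w _; exact: pb1_continuous.
- by move=> e Ve; rewrite /= s1 // s2 //; have [] := sP _ Ve.
- move=> w Bw; have [Vw sw] := sK _ Bw; rewrite /= -pb_eq; split => //.
  have Vw' : V (vb_proj (pb2 w)) by rewrite -pb_eq.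
  by apply: pb_inj; rewrite ?s1 ?s2 // -pb_eq.
- move=> e Ve; apply: pb_continuous.
    apply: (@continuous_at_near _ _ (s \o @vb_proj _ _ _ _ E)).
      have : nbhs e (@vb_proj _ _ _ _ E @^-1` V) by exact: open_nbhs_nbhs.
      by apply: filterS => e' Ve'; rewrite /= s1.
    by apply: continuous_comp; [exact: pE|exact: sc].
  apply: (@continuous_at_near _ _ id); last exact: cvg_id.
  have : nbhs e (@vb_proj _ _ _ _ E @^-1` V) by exact: open_nbhs_nbhs.
  by apply: filterS => e' Ve'; rewrite /= s2.
Qed.

Lemma pb_hausdorff : hausdorff_space pb_space.
Proof.
apply: (hausdorff_inj pb_val_continuous pb_val_inj).
by apply: hausdorff_prod; [case: (atlasP Y')|case: (atlasP E)].
Qed.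

Lemma pb_second_countable : @second_countable pb_space.
Proof.
apply: second_countable_set_type.
by apply: second_countable_prod; [case: (atlasP Y')|case: (atlasP E)].
Qed.

(** The complex structure is taken from [E] through [pb2], rather than from the product of [Y'] and
    [E] as a submanifold; this avoids the implicit function theorem. *)
Definition pb_atlas := pullback_atlas pb2 (atlas E).

Lemma pb_manifoldP : is_manifold (@differentiable_on K) pb_atlas.
Proof.
apply: (pullback_atlas_manifold aE pb2_local_homeo).
  exact: pb_hausdorff.
exact: pb_second_countable.
Qed.

Definition pb_manifold : holManifold K (n + r) := Manifold pb_manifoldP.

Let aE' := manifold_atlas pb_manifoldP.

Lemma pb_pulled_back : pulled_back pb2 pb_atlas (atlas E).
Proof.
exact: (pullback_atlas_pulled_back aE pb2_local_homeo pb_hausdorff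
  pb_second_countable).
Qed.

Lemma pb2_hol z : hol_at pb_atlas (atlas E) pb2 z.
Proof. exact: (pulled_back_hol aE pb2_local_homeo pb_pulled_back). Qed.

(** [pb1] is a continuous lift through [p] of the holomorphic map [vb_proj \o pb2]. *)
Lemma pb1_hol z : hol_at pb_atlas (atlas Y') pb1 z.
Proof.
apply: (hol_at_lift aY lp pbY (atlas_chart aE')); first exact: pb1_continuous.
have -> : p \o pb1 = @vb_proj _ _ _ _ E \o pb2.
  by apply/funext => w; exact: pb_eq.
exact: (hol_at_comp (atlas_chart aE') (atlas_chart aE) (atlas_cover aE)
  (pb2_hol z) (vb_proj_hol _)).
Qed.

Lemma pb_hol (X : topologicalType) (k : nat) (C : set (chart K X k))
    (f : X -> pb_space) x : (forall c, C c -> is_chart c) ->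
  {for x, continuous (pb1 \o f)} -> hol_at C (atlas E) (pb2 \o f) x ->
  hol_at C pb_atlas f x.
Proof.
move=> Cc f1 f2; apply: (hol_at_lift aE pb2_local_homeo pb_pulled_back) => //.
by apply: pb_continuous => //; case: f2.
Qed.

Definition pb_zero (y : Y') : pb_space :=
  exist _ (y, vb_zero E (p y))
    (@mem_set _ pb_set (y, vb_zero E (p y))
      (esym (vb_proj_zero E (p y)))).

Definition pb_add (z z' : pb_space) : pb_space :=
  pb_mk z (pb1 z) (vb_add (pb2 z) (pb2 z')).

Definition pb_scale (c : K) (z : pb_space) : pb_space :=
  pb_mk z (pb1 z) (vb_scale c (pb2 z)).

Lemma pb_addE z z' : pb1 z = pb1 z' -> pb1 (pb_add z z') = pb1 z /\
  pb2 (pb_add z z') = vb_add (pb2 z) (pb2 z').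
Proof.
move=> zz'; rewrite /pb_add.
have h : p (pb1 z) = vb_proj (vb_add (pb2 z) (pb2 z')).
  by rewrite vb_proj_add -?pb_eq // zz'.
by rewrite pb_mk1 ?pb_mk2.
Qed.

Lemma pb_scaleE c z : pb1 (pb_scale c z) = pb1 z /\
  pb2 (pb_scale c z) = vb_scale c (pb2 z).
Proof.
rewrite /pb_scale.
have h : p (pb1 z) = vb_proj (vb_scale c (pb2 z)) by rewrite vb_proj_scale pb_eq.
by rewrite pb_mk1 ?pb_mk2.
Qed.

Lemma pb_proj_zero y : pb1 (pb_zero y) = y. Proof. by []. Qed.

Lemma pb_proj_add z z' : pb1 z = pb1 z' -> pb1 (pb_add z z') = pb1 z.
Proof. by move=> /pb_addE[]. Qed.

Lemma pb_proj_scale c z : pb1 (pb_scale c z) = pb1 z.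
Proof. by have [] := pb_scaleE c z. Qed.

Lemma pb_locally_trivial (y0 : Y') :
  exists (U : set Y') (tau : pb_manifold -> 'rV[K]_r),
    [/\ open_nbhs y0 U,
      regular_iso_on (@differentiable_on _) pb_atlas
        (prod_atlas (atlas Y') (model_atlas _ r))
        (pb1 @^-1` U) (U `*` setT) (fun e => (pb1 e, tau e)),
      (forall y, U y -> tau (pb_zero y) = 0),
      (forall e e', U (pb1 e) -> pb1 e = pb1 e' ->
        tau (pb_add e e') = tau e + tau e') &
      (forall a e, U (pb1 e) -> tau (pb_scale a e) = a *: tau e)].
Proof.
have [U [tau [g [[oU Uy] tE gE [t0 tD tZ]]]]] := vb_trivialization E (p y0).
have aM := model_is_atlas K r.
exists (p @^-1` U), (tau \o pb2); split.
- by split => //; apply: open_comp.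
(* The inverse trivialization sends [(y, v)] to [(y, g (p y, v))]. The junk value also lies over
   [z.1], so [pb1 \o g'] is [fst] everywhere and not only over [U]. *)
- pose g' z := pb_mk (pb_zero z.1) z.1 (g (p z.1, z.2)).
  have g1 z : pb1 (g' z) = z.1 by rewrite /g' /pb_mk; case: pselect.
  have g2 z : U (p z.1) -> pb2 (g' z) = g (p z.1, z.2).
    by move=> Uz; rewrite pb_mk2 //; have [-> _ _] := gE (p z.1) z.2 Uz.
  have tEz z : U (p (pb1 z)) -> U (vb_proj (pb2 z)) by rewrite pb_eq.
  exists g'; split.
  + move=> z Uz; split => //; apply: pb_inj; rewrite ?g1 ?g2 //= pb_eq.
    by have [] := tE _ (tEz _ Uz).
  + move=> [y v] [/= Uy' _]; rewrite g1 /= g2 //=; split => //.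
    by have [_ -> _] := gE _ v Uy'.
  + apply/holomorphic_onP => z Uz; apply: hol_at_pair; first exact: pb1_hol.
    have [_ _ th] := tE _ (tEz _ Uz).
    exact: (hol_at_comp (atlas_chart aE') (atlas_chart aE) (atlas_cover aE)
      (pb2_hol z) th).
  + apply/holomorphic_onP => -[y v] [/= Uy' _].
    apply: pb_hol; first exact: prod_is_chart.
      have -> : pb1 \o g' = fst by apply/funext => w; exact: g1.
      exact: continuous_fst.
    have [_ _ gh] := gE _ v Uy'.
    have ph : hol_at (prod_atlas (atlas Y') (model_atlas K r))
        (prod_atlas (atlas Y) (model_atlas K r)) (fun z => (p z.1, z.2)) (y, v).
      apply: (@hol_at_prod_map _ _ _ _ _ _ _ _ _ _ _ _ _ p id) => //.
        exact: (pulled_back_hol aY lp pbY).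
      exact: atlas_hol_id.
    have := hol_at_comp (prod_is_chart aY' aM) (prod_is_chart aY aM)
      (prod_atlas_cover aY aM) ph gh.
    apply: hol_at_near; first exact: prod_is_chart.
    have : nbhs (y, v) (fst @^-1` (p @^-1` U)).
      by apply: continuous_fst; apply: pc; exact: open_nbhs_nbhs.
    by apply: filterS => w Uw /=; rewrite g2.
- by move=> y Uy'; rewrite /= t0.
- move=> e e' Ue ee' /=; have [_ ->] := pb_addE ee'.
  by rewrite tD // -?pb_eq // ee'.
- by move=> a e Ue /=; have [_ ->] := pb_scaleE a e; rewrite tZ // -pb_eq.
Qed.

Definition pb_bundle : vectorBundle Y' r :=
  @VectorBundle K n Y' r pb_manifold pb1 pb_zero pb_add pb_scale
    pb_proj_zero pb_proj_add pb_proj_scale pb_locally_trivial.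

Lemma pb_fiber_frame y (psi : 'rV[K]_r -> pb_bundle) :
  fiber_frame y psi -> fiber_frame (p y) (pb2 \o psi).
Proof.
move=> [[psiy psiinj psisurj] psil].
have {}psiy v : pb1 (psi v) = y by exact: psiy.
split; first split.
- by move=> v _ /=; rewrite -pb_eq psiy.
- move=> u v _ _ /= uv; apply: psiinj; rewrite ?inE //.
  by apply: pb_inj => //; rewrite !psiy.
- move=> e /= ey; have h : p y = vb_proj e by [].
  have [|v _ ve] := psisurj (pb_mk (psi 0) y e); first by exact: pb_mk1.
  by exists v => //=; rewrite ve pb_mk2.
- move=> b u v /=; rewrite psil /=.
  have [_ ->] : pb1 (pb_add (pb_scale b (psi u)) (psi v)) = y /\
      pb2 (pb_add (pb_scale b (psi u)) (psi v)) =
      vb_add (pb2 (pb_scale b (psi u))) (pb2 (psi v)).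
    have [|-> ->] := @pb_addE (pb_scale b (psi u)) (psi v).
      by rewrite pb_proj_scale !psiy.
    by rewrite pb_proj_scale psiy.
  by have [_ ->] := pb_scaleE b (psi u).
Qed.

End PullbackBundle.

(** * Lifting a dominating equivariant spray *)

Section EllipticCovering.
Variables (R : realType) (K : numFieldType) (iota : R -> K).
Hypothesis iota_continuous : continuous iota.
Hypothesis iota0 : iota 0 = 0.
Hypothesis iota1 : iota 1 = 1.
Variables (m n : nat) (G G' : holLieGroup K m) (Y Y' : holManifold K n).
Variables (a : holomorphic_action G Y) (a' : holomorphic_action G' Y').
Variables (q : G' -> G) (p : Y' -> Y).
Hypothesis covp : manifold_covering p.
Hypothesis qhol : forall g, hol_at (lie_atlas G') (lie_atlas G) q g.
Hypothesis qpa : action_covers q p a' a.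

Let aY := manifold_atlas (atlasP Y).
Let aY' := manifold_atlas (atlasP Y').
Let aG := manifold_atlas (lie_atlasP G).
Let aG' := manifold_atlas (lie_atlasP G').
Let cp : covering_map p. Proof. by case: covp. Qed.
Let lp := covering_local_homeo cp.
Let pbY : pulled_back p (atlas Y') (atlas Y). Proof. by case: covp. Qed.
Let hY' : hausdorff_space Y'. Proof. by case: (atlasP Y'). Qed.

Lemma act_hol (G0 : holLieGroup K m) (Y0 : holManifold K n)
    (a0 : holomorphic_action G0 Y0) z :
  hol_at (prod_atlas (lie_atlas G0) (atlas Y0)) (atlas Y0)
    (fun z => a0 z.1 z.2) z.
Proof. exact: ((holomorphic_onP _ _ _ _).1 (act_holomorphic a0)). Qed.

Section PullbackSpray.
Variables (r : nat) (E : vectorBundle Y r) (s : E -> Y).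
Hypothesis sprays : is_spray s.

Let E' := pb_bundle covp E.
Let aE := manifold_atlas (atlasP E).
Let aE' : is_atlas (atlas E') := manifold_atlas (atlasP E').
Let b1 : E' -> Y' := @pb1 K n r Y Y' p E.
Let b2 : E' -> E := @pb2 K n r Y Y' p E.

Let b1_continuous : continuous b1. Proof. exact: pb1_continuous. Qed.
Let b2_continuous : continuous b2. Proof. exact: pb2_continuous. Qed.
Let b12 z : p (b1 z) = vb_proj (b2 z). Proof. exact: pb_eq. Qed.

Let s_hol e : hol_at (atlas E) (atlas Y) s e.
Proof. by have [/holomorphic_onP sh _] := sprays; exact: sh. Qed.

Let s_zero y : s (vb_zero E y) = y. Proof. by case: sprays. Qed.

(** The homotopy to lift starts at [p \o b1], because scaling by 0 lands in the zero section. Only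
    one lifted path for each [z] is recorded: by uniqueness of lifts this already determines
    [s']. *)
Lemma lifted_spray : exists2 s' : E' -> Y', continuous s' & forall z,
  exists u : R -> Y', [/\ continuous u, u 0 = b1 z, u 1 = s' z &
    forall t : R, 0 <= t <= 1 -> p (u t) = s (vb_scale (iota t) (b2 z))].
Proof.
pose f (w : R * E') := s (vb_scale (iota w.1) (b2 w.2)).
have fc (t : R) z : 0 <= t <= 1 -> setT z -> {for (t, z), continuous f}.
  move=> _ _; apply: (@continuous_comp _ _ _
    (fun w : R * E' => vb_scale (iota w.1) (b2 w.2)) s);
    last by case: (s_hol (vb_scale (iota t) (b2 z))).
  apply: vb_scale_continuous.
    apply: (@continuous_comp _ _ _ fst iota); first exact: continuous_fst.
    exact: iota_continuous.
  apply: (@continuous_comp _ _ _ snd b2); first exact: continuous_snd.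
  exact: b2_continuous.
have f0 z : [set: E'] z -> p (b1 z) = f (0, z).
  by move=> _; rewrite /f /= iota0 vb_scale0 s_zero b12.
have [F [Fc F0 Fp]] := homotopy_lifting hY' cp openT fc
  (fun z _ => b1_continuous (x := z)) f0.
exists (fun z => F (1, z)) => z.
  by have [_] := slice_continuous (Fc 1 z I).
exists (fun t => F (t, z)); split => //.
- by move=> t; have [] := slice_continuous (Fc t z I).
- exact: F0.
- by move=> t t01; rewrite Fp.
Qed.

Variable s' : E' -> Y'.
Hypothesis s'c : continuous s'.
Hypothesis s'P : forall z, exists u : R -> Y', [/\ continuous u, u 0 = b1 z,
  u 1 = s' z &
  forall t : R, 0 <= t <= 1 -> p (u t) = s (vb_scale (iota t) (b2 z))].

Let in01 : 0 <= (1 : R) <= 1. Proof. by rewrite lexx ler01. Qed.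

Lemma lifted_sprayE z : p (s' z) = s (b2 z).
Proof.
by have [u [_ _ <- ->]] := s'P z; rewrite ?in01 // iota1 vb_scale1.
Qed.

(** To compute [s'] at a point it suffices to exhibit one lift; the zero section and equivariance
    are both handled in this way. *)
Lemma lifted_spray_unique z (v : R -> Y') : continuous v -> v 0 = b1 z ->
  (forall t : R, 0 <= t <= 1 -> p (v t) = s (vb_scale (iota t) (b2 z))) ->
  v 1 = s' z.
Proof.
move=> vc v0 pv; have [u [uc u0 <- pu]] := s'P z.
apply: (path_lift_unique hY' lp _ _ _ _ in01).
- by move=> t _; exact: vc.
- by move=> t _; exact: uc.
- by move=> t t01; rewrite pv ?pu.
- by rewrite u0.
Qed.

Lemma lifted_is_spray : is_spray (E := E') s'.
Proof.
split.
  apply/holomorphic_onP => z _.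
  apply: (hol_at_lift aY lp pbY (atlas_chart aE')); first exact: s'c.
  have -> : p \o s' = s \o b2 by apply/funext => w; exact: lifted_sprayE.
  exact: (hol_at_comp (atlas_chart aE') (atlas_chart aE) (atlas_cover aE)
    (pb2_hol covp z) (s_hol _)).
move=> y; apply/esym.
(* A zero vector stays zero under scaling, so the path to lift is constant at [p y]. *)
apply: (@lifted_spray_unique (vb_zero E' y) (fun=> y)) => //.
  exact: cst_continuous.
move=> t _; have -> : b2 (vb_zero E' y) = vb_zero E (p y) by [].
by rewrite vb_scale_zero s_zero.
Qed.

Lemma lifted_dominating : dominating s -> dominating (E := E') s'.
Proof.
move=> doms y psi psif.
apply: (submersion_at_lift aY lp aY' pbY (atlas_chart (model_is_atlas K r))).
  apply: continuous_comp; last exact: s'c.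
  exact: (fiber_frame_continuous psif).
have -> : p \o (s' \o psi) = s \o (b2 \o psi).
  by apply/funext => v; exact: lifted_sprayE.
exact: (doms _ _ (pb_fiber_frame psif)).
Qed.

Variable b : holomorphic_action G E.
Hypothesis bproj : forall g e, vb_proj (b g e) = a g (vb_proj e).
Hypothesis badd : forall g e e', vb_proj e = vb_proj e' ->
  b g (vb_add e e') = vb_add (b g e) (b g e').
Hypothesis bscale : forall g c e, b g (vb_scale c e) = vb_scale c (b g e).
Hypothesis bs : forall g e, s (b g e) = a g (s e).

Definition lifted_act (g : G') (z : E') : E' :=
  pb_mk z (a' g (b1 z)) (b (q g) (b2 z)).

Let lifted_compat g z : p (a' g (b1 z)) = vb_proj (b (q g) (b2 z)).
Proof. by rewrite qpa bproj b12. Qed.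

Lemma lifted_act1 g z : b1 (lifted_act g z) = a' g (b1 z).
Proof. exact: pb_mk1. Qed.

Lemma lifted_act2 g z : b2 (lifted_act g z) = b (q g) (b2 z).
Proof. exact: pb_mk2. Qed.

Hypothesis qM : {morph q : x y / (x * y)%g}.

Let q1 : q 1%g = 1%g.
Proof. by apply: (mulgI (q 1%g)); rewrite -qM !mulg1. Qed.

Lemma lifted_act_one z : lifted_act 1%g z = z.
Proof.
apply: pb_inj; first by rewrite -/(b1 _) lifted_act1 act1.
by rewrite -/(b2 _) lifted_act2 q1 act1.
Qed.

Lemma lifted_actM g h z :
  lifted_act (g * h)%g z = lifted_act g (lifted_act h z).
Proof.
apply: pb_inj; first by rewrite -!/(b1 _) !lifted_act1 actM.
by rewrite -!/(b2 _) !lifted_act2 qM actM.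
Qed.

Lemma lifted_act_holomorphic :
  holomorphic_on (prod_atlas (lie_atlas G') (atlas E')) (atlas E') setT
    (fun z => lifted_act z.1 z.2).
Proof.
apply/holomorphic_onP => z _.
apply: (pb_hol covp (prod_is_chart aG' aE')).
  have -> : @pb1 _ _ _ _ _ p E \o (fun z => lifted_act z.1 z.2) =
      (fun w => a' w.1 w.2) \o (fun z => (z.1, b1 z.2)).
    by apply/funext => w; exact: lifted_act1.
  apply: continuous_comp; last by case: (act_hol a' (z.1, b1 z.2)).
  apply: (@continuous_pair_at _ _ _ fst (b1 \o snd)); first exact: continuous_fst.
  by apply: continuous_comp; [exact: continuous_snd|exact: b1_continuous].
have -> : @pb2 _ _ _ _ _ p E \o (fun z => lifted_act z.1 z.2) =
    (fun w => b w.1 w.2) \o (fun z => (q z.1, b2 z.2)).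
  by apply/funext => w; exact: lifted_act2.
have h : hol_at (prod_atlas (lie_atlas G') (atlas E'))
    (prod_atlas (lie_atlas G) (atlas E)) (fun z => (q z.1, b2 z.2)) z.
  exact: (hol_at_prod_map aG' aE' (qhol z.1) (pb2_hol covp z.2)).
have bh := (holomorphic_onP _ _ _ _).1 (act_holomorphic b) (q z.1, b2 z.2) I.
exact: (hol_at_comp (prod_is_chart aG' aE') (prod_is_chart aG aE)
  (prod_atlas_cover aG aE) h bh).
Qed.

Definition lifted_action : holomorphic_action G' E' :=
  @HolomorphicAction K m (n + r) G' E' lifted_act lifted_act_one lifted_actM
    lifted_act_holomorphic.

Lemma lifted_equivariant : equivariant_spray (E := E') a' s'.
Proof.
exists lifted_action; split.
- exact: lifted_act1.
- move=> g z z' zz'.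
  have h : b1 (lifted_act g z) = b1 (lifted_act g z').
    by rewrite !lifted_act1; congr (a' g _).
  have [e1 e2] := pb_addE zz'; have [e3 e4] := pb_addE h.
  have bz : vb_proj (b2 z) = vb_proj (b2 z') by rewrite -!b12; congr (p _).
  apply: pb_inj.
    exact: (etrans (lifted_act1 _ _) (etrans (congr1 (a' g) e1)
      (esym (etrans e3 (lifted_act1 _ _))))).
  exact: (etrans (lifted_act2 _ _) (etrans (congr1 (b (q g)) e2)
    (etrans (badd _ bz) (esym (etrans e4
      (f_equal2 (@vb_add _ _ _ _ E) (lifted_act2 _ _) (lifted_act2 _ _))))))).
- move=> g c z.
  have [e1 e2] := pb_scaleE c z; have [e3 e4] := pb_scaleE c (lifted_act g z).
  apply: pb_inj.
    exact: (etrans (lifted_act1 _ _) (etrans (congr1 (a' g) e1)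
      (esym (etrans e3 (lifted_act1 _ _))))).
  exact: (etrans (lifted_act2 _ _) (etrans (congr1 (b (q g)) e2)
    (etrans (bscale _ _ _) (esym (etrans e4
      (congr1 (vb_scale c) (lifted_act2 _ _))))))).
(* Fibrewise linearity of [b] moves the ray through [b2 z] to the ray through [b (q g) (b2 z)], so
   translating the lifted path [u] by [a' g] gives the lift that belongs to [lifted_act g z]. *)
- move=> g z; apply/esym; have [u [uc u0 u1 pu]] := s'P z.
  rewrite -u1.
  apply: (@lifted_spray_unique (lifted_act g z) (fun t => a' g (u t))).
  + move=> t; apply: (@continuous_comp _ _ _ (fun t => (g, u t))
      (fun w => a' w.1 w.2)); last by case: (act_hol a' (g, u t)).
    by apply: continuous_pair_at; [exact: cst_continuous|exact: uc].
  + by rewrite u0 lifted_act1.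
  + by move=> t t01; rewrite qpa pu // -bs bscale lifted_act2.
Qed.

End PullbackSpray.

Theorem elliptic_covering : {morph q : x y / (x * y)%g} ->
  elliptic a -> elliptic a'.
Proof.
move=> qM [r [E [s [sprays doms [b [b1 b2 b3 b4]]]]]].
have [s' s'c s'P] := lifted_spray sprays.
exists r, (pb_bundle covp E), s'; split.
- exact: (lifted_is_spray sprays s'c s'P).
- exact: (lifted_dominating s'c s'P doms).
- exact: (lifted_equivariant s'P b1 b2 b3 b4 qM).
Qed.

End EllipticCovering.

(** * The group of lifts *)

Section LocalLift.
Variables (R : realType) (K : numFieldType) (iota : R -> K).
Hypothesis iota_continuous : continuous iota.
Hypothesis iota0 : iota 0 = 0.
Hypothesis iota1 : iota 1 = 1.
Hypothesis iota_le1 : forall t : R, 0 <= t <= 1 -> `|iota t| <= 1.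

(** [U] is a ball in a chart and [l (t, u)] runs along the segment from [x0] to [u]; the bound on
    [iota] keeps segments inside balls about [x0]. By the last clause points near [x0] have short
    segments, which later keeps products of group elements inside [U]. *)
Lemma star_shaped_nbhs (n : nat) (T : topologicalType) (A : set (chart K T n))
    (x0 : T) : is_atlas A -> exists (U : set T) (l : R * T -> T),
  [/\ open_nbhs x0 U,
    (forall (t : R) u, U u -> {for (t, u), continuous l} /\ U (l (t, u))),
    (forall u, U u -> l (0, u) = x0 /\ l (1, u) = u),
    (forall t, l (t, x0) = x0) &
    forall W, nbhs x0 W -> \forall u \near x0, forall t, W (l (t, u))].
Proof.
move=> aA; have [c cA cx] := atlas_cover aA x0.
have cc := atlas_chart aA cA.
have ball_nbhs (P : set T) : nbhs x0 P -> exists2 e : K, 0 < e &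
    forall v, ball (c x0) e v ->
    [/\ chart_dom c (chart_inv c v), c (chart_inv c v) = v & P (chart_inv c v)].
  by move=> /(chart_inv_near cc cx) /nbhs_ballP.
pose g (z : R * T) := c x0 + iota (clamp z.1) *: (c z.2 - c x0).
have gball (e : K) t u : ball (c x0) e (c u) -> ball (c x0) e (g (t, u)).
  rewrite -ball_normE /ball_ /= => h.
  rewrite /g /= opprD addNKr normrN normrZ.
  apply: le_lt_trans (ler_piMl (normr_ge0 _) (iota_le1 (clamp01 t))) _.
  by rewrite distrC.
have [e e0 eP] := ball_nbhs setT filterT.
pose U := chart_dom c `&` c @^-1` ball (c x0) e.
pose l := chart_inv c \o g.
have oU : open U.
  rewrite openE => u [cu bu]; apply: filterI; first exact: (chart_dom_near cc).
  apply: (chart_continuous cc cu); apply: open_nbhs_nbhs.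
  by split => //; exact: ball_open.
have Ux : U x0 by split => //=; exact: ballxx.
have near_ball (d : K) : 0 < d ->
    \forall u \near x0, chart_dom c u /\ ball (c x0) d (c u).
  move=> d0; apply: filterI; first exact: (chart_dom_near cc).
  by apply: (chart_continuous cc cx); exact: nbhsx_ballx.
exists U, l; split => //.
- move=> t u [cu bu]; have [c1 c2 _] := eP _ (gball e t u bu); split; last first.
    by split => //=; rewrite /l /= c2; exact: gball.
  apply: continuous_comp; last first.
    by rewrite -c2; exact: (chart_inv_continuous cc).
  apply: (@cvgD _ _ _ _ _ (cst (c x0))); first exact: cvg_cst.
  apply: cvgZ.
    apply: (@continuous_comp _ _ _ (@clamp R \o fst) iota).
      apply: continuous_comp; first exact: continuous_fst.
      exact: clamp_continuous.
    exact: iota_continuous.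
  apply: cvgB; last exact: cvg_cst.
  apply: (@continuous_comp _ _ _ snd c); first exact: continuous_snd.
  exact: (chart_continuous cc).
- move=> u [cu bu]; rewrite /l /g /=; split.
    by rewrite clamp_id ?lexx ?ler01 // iota0 scale0r addr0 (chart_invK cc).
  rewrite clamp_id ?lexx ?ler01 // iota1 scale1r addrC subrK.
  by rewrite (chart_invK cc).
- by move=> t; rewrite /l /g /= subrr scaler0 addr0 (chart_invK cc).
- move=> W Wx; have [d d0 dP] := ball_nbhs _ Wx.
  by apply: filterS (near_ball _ d0) => u [cu bu] t; have [] := dP _ (gball d t u bu).
Qed.

Variables (m n : nat) (G : holLieGroup K m) (Y Y' : holManifold K n).
Variables (a : holomorphic_action G Y) (p : Y' -> Y).
Hypothesis cp : covering_map p.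

Let aG := manifold_atlas (lie_atlasP G).
Let lp := covering_local_homeo cp.
Let hY' : hausdorff_space Y'. Proof. by case: (atlasP Y'). Qed.
Let in01 : 0 <= (1 : R) <= 1. Proof. by rewrite lexx ler01. Qed.

Lemma act_continuous (X : topologicalType) (f : X -> G) (g : X -> Y) x :
  {for x, continuous f} -> {for x, continuous g} ->
  {for x, continuous (fun z => a (f z) (g z))}.
Proof.
move=> fc gc; apply: (@continuous_comp _ _ _ (fun z => (f z, g z))
  (fun w => a w.1 w.2)); first exact: continuous_pair_at.
by case: (act_hol a (f x, g x)).
Qed.

Definition path_from_one (W : set G) (u : G) : Prop := exists g : R -> G,
  [/\ continuous g, g 0 = 1%g, g 1 = u & forall t, W (g t)].

(** Taking [(u, y)] as the parameter of one homotopy makes [mu] jointly continuous; for [u = 1] the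
    segment is constant, so [mu 1] is the identity. The segments themselves are forgotten: only the
    two clauses on paths are exported. *)
Lemma local_action_lift : exists (U : set G) (mu : G -> Y' -> Y'),
  [/\ open_nbhs 1%g U,
    (forall W, nbhs 1%g W -> \forall u \near 1%g, path_from_one W u),
    (forall u y, U u -> {for (u, y), continuous (fun z => mu z.1 z.2)}),
    (forall u y, U u -> p (mu u y) = a u (p y)) &
    (forall y, mu 1%g y = y) /\ forall u, U u -> path_from_one U u].
Proof.
have [U [l [[oU U1] lU l01 l1 lW]]] := star_shaped_nbhs (1%g : G) aG.
have lc u : U u -> continuous (fun t => l (t, u)).
  by move=> Uu t; have [/slice_continuous[]] := lU t u Uu.
pose f (w : R * (G * Y')) := a (l (w.1, w.2.1)) (p w.2.2).
pose D : set (G * Y') := U `*` setT.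
have oD : open D.
  rewrite (_ : D = fst @^-1` U); last by apply/seteqP; split => [z []|z].
  by apply: open_comp => // z _; exact: continuous_fst.
have fc (t : R) z : 0 <= t <= 1 -> D z -> {for (t, z), continuous f}.
  case: z => u y _ [/= Uu _]; apply: act_continuous.
    apply: (@continuous_comp _ _ _ (fun w : R * (G * Y') => (w.1, w.2.1)) l).
      apply: continuous_pair_at; first exact: continuous_fst.
      apply: (@continuous_comp _ _ _ snd fst); first exact: continuous_snd.
      exact: continuous_fst.
    by have [] := lU t u Uu.
  apply: (@continuous_comp _ _ _ (snd \o snd) p); last by have [pc _] := lp; exact: pc.
  by apply: continuous_comp; exact: continuous_snd.
have f0c z : D z -> {for z, continuous (@snd G Y')}.
  by move=> _; exact: continuous_snd.
have pf0 z : D z -> p z.2 = f (0, z).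
  by case: z => u y [/= Uu _]; rewrite /f /=; have [-> _] := l01 u Uu; rewrite act1.
have [F [Fc F0 Fp]] := homotopy_lifting hY' cp oD fc f0c pf0.
have DE u y : U u -> D (u, y) by [].
exists U, (fun u y => F (1, (u, y))); split => //; last split.
- move=> W Wx; have : nbhs (1%g : G) U by exact: open_nbhs_nbhs.
  apply: filterS2 (lW W Wx) => u lWu Uu.
  exists (fun t => l (t, u)); split => //; first exact: lc.
    by have [] := l01 u Uu.
  by have [] := l01 u Uu.
- move=> u y Uu.
  have -> : (fun z : G * Y' => F (1, (z.1, z.2))) = (fun z => F (1, z)).
    by apply/funext => -[].
  by have [_] := slice_continuous (Fc 1 (u, y) (DE u y Uu)).
- by move=> u y Uu; rewrite Fp // /f /=; have [_ ->] := l01 u Uu.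
- move=> y; apply: (path_lift_unique hY' lp (u := fun t => F (t, (1%g, y)))
    (v := fun=> y) _ _ _ _ in01).
  + by move=> t _; have [] := slice_continuous (Fc t (1%g, y) (DE _ y U1)).
  + by move=> t _; exact: cst_continuous.
  + by move=> t t01; rewrite Fp // /f /= l1 act1.
  + by rewrite F0.
- move=> u Uu; exists (fun t => l (t, u)); split => //; first exact: lc.
  + by have [] := l01 u Uu.
  + by have [] := l01 u Uu.
  + by move=> t; have [] := lU t u Uu.
Qed.

End LocalLift.

(** * Coverings with finite fibres *)

Section CoveringFacts.

(** Enumerating [A] by a list embeds [Q], through evaluation, into lists whose entries range over
    the finite sets [B x]. This will count lifts by their values on one fibre. *)
Lemma finite_set_eval (H T T' : Type) (Q : set H) (ev : H -> T -> T')
    (A : set T) (B : T -> set T') : finite_set A ->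
  (forall x, A x -> finite_set (B x)) ->
  (forall h x, Q h -> A x -> B x (ev h x)) ->
  (forall h k, Q h -> Q k -> (forall x, A x -> ev h x = ev k x) -> h = k) ->
  finite_set Q.
Proof.
move=> fA fB QB Qinj.
have [s sA] : exists s : seq {classic T}, A = [set` s] by exact/finite_seqP.
have fL (l : seq {classic T}) : (forall x, x \in l -> finite_set (B x)) ->
    finite_set [set r | exists2 f : T -> T', (forall x, x \in l -> B x (f x)) &
      r = map f l].
  elim: l => [|x l IH] fl.
    by apply: sub_finite_set (finite_set1 [::]) => r [f _ ->].
  have fl' : forall y, y \in l -> finite_set (B y).
    by move=> y yl; apply: fl; rewrite inE yl orbT.
  have fx : finite_set (B x) by apply: fl; rewrite inE eqxx.
  apply: sub_finite_set (finite_image2 cons fx (IH fl')) => r [f fB' ->].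
  exists (f x); first by apply: fB'; rewrite inE eqxx.
  exists (map f l) => //; exists f => // y yl.
  by apply: fB'; rewrite inE yl orbT.
have fs : forall x, x \in s -> finite_set (B x).
  by move=> x xs; apply: fB; rewrite sA.
apply: (@sub_finite_set _ _ (\bigcup_(r in [set r | exists2 f : T -> T',
    (forall x, x \in s -> B x (f x)) & r = map f s])
    [set h | Q h /\ map (ev h) s = r])).
  move=> h Qh; exists (map (ev h) s) => //; exists (ev h) => // x xs.
  by apply: QB => //; rewrite sA.
apply: bigcup_finite => [|r _]; first exact: fL.
have [[h [Qh hr]]|nh] := pselect (exists h, Q h /\ map (ev h) s = r); last first.
  by apply: sub_finite_set (finite_set0 H) => h Qh; apply: nh; exists h.
apply: sub_finite_set (finite_set1 h) => k [Qk kr]; apply: Qinj => // x.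
rewrite sA /=; move: kr; rewrite -hr => kh xs.
exact: (proj2 (@eq_in_map {classic T} T' (ev k) (ev h) s) kh x xs).
Qed.

(** For a nonempty basic set [W] inside an evenly covered set, the finite fibre over one reference
    point of [W] labels the sheets, so only countably many pieces of sheets over basic sets
    occur. *)
Lemma covering_second_countable (T S : topologicalType) (p : T -> S) :
  covering_map p -> finite_fibers p -> @second_countable S ->
  @second_countable T.
Proof.
move=> [pc _ pV] fp [B cB [Bo Bb]].
pose good (W : set S) := exists V, [/\ open V, W `<=` V, W !=set0 &
  evenly_covered p V].
have /choice[F FP] : forall W : set S, exists F : set (set T), good W ->
    exists V, [/\ open V, W `<=` V, trivIset F id, \bigcup_(C in F) C = p @^-1` V
      & forall C, F C -> [/\ open C, set_bij C V p &
          forall Q0, open Q0 -> Q0 `<=` C -> open (p @` Q0)]].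
  move=> W; have [[V [oV WV _ [F [F1 F2 F3]]]]|nW] := pselect (good W);
    last by exists set0.
  by exists F => _; exists V.
have /choice[X XP] : forall W : set S, exists X : set T, countable X /\
    (good W -> exists2 w, W w & X = p @^-1` [set w]).
  move=> W; have [[V [_ _ [w Ww] _]]|nW] := pselect (good W).
    exists (p @^-1` [set w]); split; last by move=> _; exists w.
    by apply: finite_set_countable; exact: fp.
  by exists set0; split => //; exact: countable0.
(* The part over [W.2] of the sheet through [x]. For good [W.1] the sheets are disjoint, so the
   union has at most one member, which spares a choice. *)
pose base (W : set S * set S) (x : T) :=
  \bigcup_(C in F W.1 `&` [set C | C x]) (C `&` p @^-1` W.2).
exists (\bigcup_(W in (B `&` good) `*` B) [set base W x | x in X W.1]).
  apply: bigcup_countable.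
    apply: countableX => //; apply: sub_countable cB.
    by apply: subset_card_le => W [].
  move=> W _; apply: sub_countable (card_image_le _ _) _.
  by have [] := XP W.1.
split.
  move=> _ [[W W'] [/= [BW gW] BW'] [x _ <-]].
  apply: bigcup_open => C [FC _]; have [V [_ _ _ _ /(_ C FC)[oC _ _]]] := FP W gW.
  by apply: openI => //; apply: open_comp => //; exact: Bo.
move=> x N Nx.
have [V [oV Vx] eV] := pV (p x).
have [|W [BW Wx] WV] := Bb (p x) V; first exact: open_nbhs_nbhs.
have gW : good W by exists V; split => //; exists (p x).
have [V' [oV' WV' tF FV' FP']] := FP W gW.
have : (p @^-1` V') x by exact: WV'.
rewrite -FV' => -[C FC Cx]; have [oC [CV Cinj Csurj] pC] := FP' C FC.
have [Q0 [oO Ox] ON] : exists2 Q0, open_nbhs x Q0 & Q0 `<=` N.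
  by move: Nx; rewrite nbhsE.
have [|W' [BW' W'x] W'Q0] := Bb (p x) (p @` (Q0 `&` C)).
  apply: open_nbhs_nbhs; split; last by exists x.
  by apply: pC; [exact: openI|move=> z []].
have [_ /(_ gW)[w Ww XW]] := XP W.
have [x0 Cx0 px0] := Csurj w (WV' _ Ww).
exists (base (W, W') x0).
  split; last by exists C.
  by exists (W, W') => //; exists x0; rewrite // XW.
move=> z [C' [/= FC' C'x0] [C'z W'z]].
have C'C : C' = C by apply: tF => //; exists x0.
have [z' [Oz' Cz'] zz'] := W'Q0 _ W'z.
apply: ON; rewrite (_ : z = z') //.
by apply: Cinj; rewrite ?inE -?C'C //; rewrite C'C.
Qed.

(** [T] may be disconnected, so [u = v] is tested on whole fibres over points of [S]. The set of
    points passing the test is open, since only finitely many sheets have to be controlled at once,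
    and its complement is open because [Z] is Hausdorff. *)
Lemma covering_lifts_eq (T S Z S' : topologicalType) (p : T -> S) (r : Z -> S')
    (u v : T -> Z) (y0 : S) :
  covering_map p -> finite_fibers p -> connected [set: S] ->
  local_homeo r -> hausdorff_space Z -> continuous u -> continuous v ->
  (forall x, r (u x) = r (v x)) -> (forall x, p x = y0 -> u x = v x) ->
  u = v.
Proof.
move=> [pc _ pV] fp cS lr hZ uc vc ruv uv0.
pose D := [set y | forall x, p x = y -> u x = v x].
suff DT : D = setT by apply/funext => x; apply: (_ : D (p x)) => //; rewrite DT.
apply: cS; first by exists y0.
  exists D; last by rewrite setTI.
  rewrite openE => y Dy; rewrite /interior.
  have [V [oV Vy] [F [tF FV FP]]] := pV y.
  (* [Q x y'] is agreement at the point over [y'] in the sheet that contains [x]. *)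
  pose Q x y' := forall C, F C -> C x -> forall w, C w -> p w = y' -> u w = v w.
  have nQ x : p x = y -> \forall y' \near y, Q x y'.
    move=> xy; have : (p @^-1` V) x by rewrite /= xy.
    rewrite -FV => -[C FC Cx]; have [oC [CV Cinj Csurj] pC] := FP C FC.
    have : nbhs x [set w | u w = v w].
      have := lift_eq_near lr (uc x) (vc x) (Dy x xy).
      by apply: filterS => w; apply; exact: ruv.
    rewrite nbhsE => -[Q0 [oO Ox] Ouv].
    have : nbhs y (p @` (Q0 `&` C)).
      apply: open_nbhs_nbhs; split; last by exists x.
      by apply: pC; [exact: openI|move=> z []].
    apply: filterS => y' [w' [Ow' Cw'] w'y] C' FC' C'x w C'w wy.
    have CC' : C' = C by apply: tF => //; exists x.
    rewrite (_ : w = w'); first exact: Ouv.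
    by apply: Cinj; rewrite ?inE -?CC' //; rewrite ?CC' // wy w'y.
  have nQ' : \forall y' \near y, forall x, p x = y -> Q x y'.
    have [s sE] : exists s : seq {classic T}, p @^-1` [set y] = [set` s].
      by apply/finite_seqP; exact: fp.
    have : forall x, x \in s -> p x = y.
      by move=> x xs; have : (p @^-1` [set y]) x by rewrite sE.
    have sub : forall x, p x = y -> x \in s.
      by move=> x xy; have : [set` s] x by rewrite -sE.
    (* One neighbourhood for each point of the fibre; they are intersected by induction on the
       list. *)
    move=> sy; have : \forall y' \near y, forall x, x \in s -> Q x y'.
      elim: s sy {sE sub} => [|x s IH] sy; first by apply: nearW.
      have nx : \forall y' \near y, Q x y' by apply: nQ; apply: sy; rewrite inE eqxx.
      have ns : \forall y' \near y, forall x, x \in s -> Q x y'.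
        by apply: IH => z zs; apply: sy; rewrite inE zs orbT.
      by apply: filterS2 nx ns => y' Qx Qs z; rewrite inE => /orP[/eqP->|/Qs].
    by apply: filterS => y' Qs x xy; apply: Qs; exact: sub.
  have nV : nbhs y V by exact: open_nbhs_nbhs.
  apply: filterS2 nV nQ' => y' Vy' Qy' w wy'.
  have : (p @^-1` V) w by rewrite /= wy'.
  rewrite -FV => -[C FC Cw]; have [oC [CV Cinj Csurj] pC] := FP C FC.
  have [x Cx xy] := Csurj y Vy.
  exact: (Qy' x xy C FC Cx w Cw wy').
exists D; last by rewrite setTI.
rewrite -[D]setCK; apply: open_closedC; rewrite openE => y.
move=> /existsNP[x /not_implyP[xy uvx]].
have [V [oV Vy] [F [tF FV FP]]] := pV y.
have : (p @^-1` V) x by rewrite /= xy.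
rewrite -FV => -[C FC Cx]; have [oC _ pC] := FP C FC.
have : nbhs x [set w | u w <> v w] := hausdorff_neq_near hZ (uc x) (vc x) uvx.
rewrite nbhsE => -[Q0 [oO Ox] Ouv].
have : nbhs y (p @` (Q0 `&` C)).
  apply: open_nbhs_nbhs; split; last by exists x.
  by apply: pC; [exact: openI|move=> z []].
by apply: filterS => _ [w [Ow _] <-] Dw; apply: (Ouv w Ow); exact: Dw.
Qed.

End CoveringFacts.

Section LieGroupContinuity.
Variables (K : numFieldType) (m : nat) (G : holLieGroup K m).

Lemma lie_mul_hol z : hol_at (prod_atlas (lie_atlas G) (lie_atlas G))
  (lie_atlas G) (fun z => z.1 * z.2)%g z.
Proof. exact: ((holomorphic_onP _ _ _ _).1 (lie_mulP G)). Qed.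

Lemma lie_inv_hol z : hol_at (lie_atlas G) (lie_atlas G) (fun x => x^-1)%g z.
Proof. exact: ((holomorphic_onP _ _ _ _).1 (lie_invP G)). Qed.

Lemma lie_mul_continuous (X : topologicalType) (f g : X -> G) x :
  {for x, continuous f} -> {for x, continuous g} ->
  {for x, continuous (fun z => f z * g z)%g}.
Proof.
move=> fc gc; apply: (@continuous_comp _ _ _ (fun z => (f z, g z))
  (fun w : G * G => (w.1 * w.2)%g)); first exact: continuous_pair_at.
by case: (lie_mul_hol (f x, g x)).
Qed.

Lemma lie_inv_continuous (X : topologicalType) (f : X -> G) x :
  {for x, continuous f} -> {for x, continuous (fun z => (f z)^-1)%g}.
Proof.
move=> fc; apply: (@continuous_comp _ _ _ f (fun w : G => (w^-1)%g)) => //.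
by case: (lie_inv_hol (f x)).
Qed.

End LieGroupContinuity.

(** * Topology, complex structure and action of the group of lifts *)

Section ActionLifts.
Variables (R : realType) (K : numFieldType) (m n : nat) (G : holLieGroup K m).
Variables (Y Y' : holManifold K n) (a : holomorphic_action G Y) (p : Y' -> Y).
Hypothesis cp : covering_map p.

Let lp := covering_local_homeo cp.
Let hY' : hausdorff_space Y'. Proof. by case: (atlasP Y'). Qed.
Let pc : continuous p. Proof. by have [] := lp. Qed.
Let in01 : 0 <= (1 : R) <= 1. Proof. by rewrite lexx ler01. Qed.

Lemma lift_end_unique (u v : R -> Y') : continuous u -> continuous v ->
  (forall t, 0 <= t <= 1 -> p (u t) = p (v t)) -> u 0 = v 0 ->
  forall t, 0 <= t <= 1 -> u t = v t.
Proof.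
move=> uc vc puv uv0; apply: (path_lift_unique hY' lp) => //.
  by move=> t _; exact: uc.
by move=> t _; exact: vc.
Qed.

(** Continuity is asked at all real times and the lifting equation only on [0, 1], which is what
    [homotopy_lifting] delivers. *)
Definition isotopy_lift (g : R -> G) (f : R * Y' -> Y') : Prop :=
  [/\ continuous g, continuous f, g 0 = 1%g, (forall y, f (0, y) = y) &
    forall (t : R) y, 0 <= t <= 1 -> p (f (t, y)) = a (g t) (p y)].

Definition action_lift (g : G) (phi : Y' -> Y') : Prop :=
  exists (c : R -> G) (f : R * Y' -> Y'),
    [/\ isotopy_lift c f, g = c 1 & phi = fun y => f (1, y)].

Let slice1 (f : R * Y' -> Y') y :
  continuous f -> continuous (fun t => f (t, y)).
Proof. by move=> fc t; have [] := slice_continuous (fc (t, y)). Qed.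

Let compose_path (f : R * Y' -> Y') (u : R -> Y') :
  continuous f -> continuous u -> continuous (fun t => f (t, u t)).
Proof.
move=> fc uc t; apply: (@continuous_comp _ _ _ (fun s => (s, u s)) f).
  by apply: (@continuous_pair_at _ _ _ id u); [exact: cvg_id|exact: uc].
exact: fc.
Qed.

Lemma action_lift_continuous g phi : action_lift g phi -> continuous phi.
Proof.
move=> [c [f [[_ fc _ _ _] _ ->]]] y.
by have [] := slice_continuous (fc (1, y)).
Qed.

Lemma action_liftE g phi y : action_lift g phi -> p (phi y) = a g (p y).
Proof. by move=> [c [f [[_ _ _ _ fE] -> ->]]]; exact: fE. Qed.

Lemma action_lift1 : action_lift 1%g id.
Proof.
exists (fun=> 1%g), snd; split => //; split => //; first exact: cst_continuous.
  exact: continuous_snd.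
by move=> t y _ /=; rewrite act1.
Qed.

Lemma action_liftM g h phi psi : action_lift g phi -> action_lift h psi ->
  action_lift (g * h)%g (phi \o psi).
Proof.
move=> [c [f [[cc fc c0 f0 pf] -> ->]]] [d [k [[dc kc d0 k0 pk] -> ->]]].
exists (fun t => c t * d t)%g, (fun z => f (z.1, k z)); split => //; split.
- by move=> t; apply: lie_mul_continuous; [exact: cc|exact: dc].
- move=> z; apply: (@continuous_comp _ _ _ (fun w : R * Y' => (w.1, k w)) f);
    last exact: fc.
  by apply: continuous_pair_at; [exact: continuous_fst|exact: kc].
- by rewrite /= c0 d0 mulg1.
- by move=> y /=; rewrite k0 f0.
- by move=> t y t01 /=; rewrite pf // pk // actM.
Qed.

(** Inverting [f] at each time would leave joint continuity to be shown. Instead the inverse path in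
    [G] is lifted as well, and both composites are lifts of constant paths. *)
Lemma action_liftV g phi : action_lift g phi ->
  exists psi, [/\ action_lift g^-1%g psi, phi \o psi = id & psi \o phi = id].
Proof.
move=> [c [f [[cc fc c0 f0 pf] -> ->]]].
have kc0 (t : R) y : 0 <= t <= 1 -> [set: Y'] y ->
    {for (t, y), continuous (fun w => a (c w.1)^-1%g (p w.2))}.
  move=> _ _; apply: act_continuous.
    apply: lie_inv_continuous.
    by apply: (@continuous_comp _ _ _ fst c); [exact: continuous_fst|exact: cc].
  by apply: (@continuous_comp _ _ _ snd p); [exact: continuous_snd|exact: pc].
have pid y : [set: Y'] y -> p y = a (c 0)^-1%g (p y).
  by move=> _; rewrite c0 invg1 act1.
have [k [kc k0 pk]] := homotopy_lifting hY' cp (@openT _) kc0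
  (fun y _ => @cvg_id _ (nbhs y)) pid.
have {}kc : continuous k by move=> [t y]; exact: kc.
have fk (t : R) y : 0 <= t <= 1 -> f (t, k (t, y)) = y.
  apply: (@lift_end_unique (fun t => f (t, k (t, y))) (fun=> y)).
  - by apply: compose_path => //; exact: slice1.
  - exact: cst_continuous.
  - by move=> s s01; rewrite pf // pk // -actM mulgV act1.
  - by rewrite f0 k0.
have kf (t : R) y : 0 <= t <= 1 -> k (t, f (t, y)) = y.
  apply: (@lift_end_unique (fun t => k (t, f (t, y))) (fun=> y)).
  - by apply: compose_path => //; exact: slice1.
  - exact: cst_continuous.
  - by move=> s s01; rewrite pk // pf // -actM mulVg act1.
  - by rewrite k0 // f0.
exists (fun y => k (1, y)); split.
- exists (fun t => (c t)^-1%g), k; split => //; split => //.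
  + by move=> t; apply: lie_inv_continuous; exact: cc.
  + by rewrite /= c0 invg1.
  + by move=> y; exact: k0.
  + by move=> t y t01; exact: pk.
- by apply/funext => y /=; exact: fk.
- by apply/funext => y /=; exact: kf.
Qed.

(* The isotopies in [action_lift] confine this group to the identity component
   of the group of all lifts, which makes it a connected covering of [G]. *)
Record lift_group := LiftGroup {
  lift_base : G;
  lift_map : Y' -> Y';
  lift_mapP : action_lift lift_base lift_map }.

Lemma lift_group_inj x y : lift_base x = lift_base y ->
  lift_map x =1 lift_map y -> x = y.
Proof.
case: x y => [g phi h] [g' phi' h'] /= gg' /funext ff'.
by subst; congr LiftGroup; exact: Prop_irrelevance.
Qed.

Definition lift_one := LiftGroup action_lift1.

Definition lift_mul x y := LiftGroup (action_liftM (lift_mapP x) (lift_mapP y)).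

Definition lift_inv x :=
  let h := cid (action_liftV (lift_mapP x)) in
  LiftGroup (let: And3 h1 _ _ := projT2 h in h1).

Lemma lift_invP x : lift_map x \o lift_map (lift_inv x) = id /\
  lift_map (lift_inv x) \o lift_map x = id.
Proof. by rewrite /lift_inv /=; case: cid => psi []. Qed.

Lemma lift_mulA : associative lift_mul.
Proof. by move=> x y z; apply: lift_group_inj => //=; exact: mulgA. Qed.

Lemma lift_mul1g : left_id lift_one lift_mul.
Proof. by move=> x; apply: lift_group_inj => //=; exact: mul1g. Qed.

Lemma lift_mulg1 : right_id lift_one lift_mul.
Proof. by move=> x; apply: lift_group_inj => //=; exact: mulg1. Qed.

Lemma lift_mulVg : left_inverse lift_one lift_inv lift_mul.
Proof.
move=> x; apply: lift_group_inj => [|y]; first exact: mulVg.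
by have [_ /(congr1 (fun f => f y))] := lift_invP x.
Qed.

Lemma lift_mulgV : right_inverse lift_one lift_inv lift_mul.
Proof.
move=> x; apply: lift_group_inj => [|y]; first exact: mulgV.
by have [/(congr1 (fun f => f y))] := lift_invP x.
Qed.

HB.instance Definition _ := gen_eqMixin lift_group.
HB.instance Definition _ := gen_choiceMixin lift_group.
HB.instance Definition _ := isGroup.Build lift_group
  lift_mulA lift_mul1g lift_mulg1 lift_mulVg lift_mulgV.

Lemma lift_baseM x y : lift_base (x * y)%g = (lift_base x * lift_base y)%g.
Proof. by []. Qed.

Lemma lift_baseV x : lift_base x^-1%g = (lift_base x)^-1%g.
Proof. by []. Qed.

Lemma lift_mapM x y z : lift_map (x * y)%g z = lift_map x (lift_map y z).
Proof. by []. Qed.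

Lemma lift_map1 z : lift_map 1%g z = z. Proof. by []. Qed.

Lemma lift_mapVK x z : lift_map x (lift_map x^-1%g z) = z.
Proof. by rewrite -lift_mapM mulgV lift_map1. Qed.

Lemma lift_map_continuous x : continuous (lift_map x).
Proof. exact: action_lift_continuous (lift_mapP x). Qed.

Lemma lift_mapE x y : p (lift_map x y) = a (lift_base x) (p y).
Proof. exact: action_liftE (lift_mapP x). Qed.

Variables (U : set G) (mu : G -> Y' -> Y').
Hypothesis U1 : open_nbhs 1%g U.
Hypothesis pathU : forall W, nbhs 1%g W ->
  \forall u \near 1%g, @path_from_one R K m G W u.
Hypothesis muc : forall u y, U u ->
  {for (u, y), continuous (fun z => mu z.1 z.2)}.
Hypothesis pmu : forall u y, U u -> p (mu u y) = a u (p y).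
Hypothesis mu1 : forall y, mu 1%g y = y.
Hypothesis UpathU : forall u, U u -> @path_from_one R K m G U u.

Let nU1 : nbhs 1%g U. Proof. exact: open_nbhs_nbhs. Qed.
Let Uone : U 1%g. Proof. by case: U1. Qed.
Let oU : open U. Proof. by case: U1. Qed.

Let mu_continuous (X : topologicalType) (f : X -> G) (g : X -> Y') x :
  {for x, continuous f} -> {for x, continuous g} -> U (f x) ->
  {for x, continuous (fun z => mu (f z) (g z))}.
Proof.
move=> fc gc Ux; apply: (@continuous_comp _ _ _ (fun z => (f z, g z))
  (fun z => mu z.1 z.2)); first exact: continuous_pair_at.
exact: muc.
Qed.

(* Unique path lifting determines [mu]; every identity about the local section
   [lift_sec] is an instance of this. *)
Let mu_path (c : R -> G) (u : R -> Y') : continuous c -> continuous u ->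
  (forall t, U (c t)) -> c 0 = 1%g ->
  (forall t, 0 <= t <= 1 -> p (u t) = a (c t) (p (u 0))) ->
  u 1 = mu (c 1) (u 0).
Proof.
move=> cc uc cU c0 pu.
apply: (@lift_end_unique u (fun t => mu (c t) (u 0))) => //.
- move=> t; apply: mu_continuous => //; first exact: cc.
  exact: cst_continuous.
- by move=> t t01; rewrite pu // pmu.
- by rewrite c0 mu1.
Qed.

Let mu_action_lift u : U u -> action_lift u (mu u).
Proof.
move=> /UpathU[c [cc c0 <- cU]].
exists c, (fun z => mu (c z.1) z.2); split => //; split => //.
- move=> z; apply: mu_continuous => //; last exact: continuous_snd.
  by apply: (@continuous_comp _ _ _ fst c); [exact: continuous_fst|exact: cc].
- by move=> y /=; rewrite c0 mu1.
- by move=> t y _ /=; rewrite pmu.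
Qed.

(* Outside [U] the value [1] is junk. *)
Definition lift_sec (u : G) : lift_group :=
  if pselect (U u) is left h then LiftGroup (mu_action_lift h) else 1%g.

Lemma lift_sec_base u : U u -> lift_base (lift_sec u) = u.
Proof. by rewrite /lift_sec; case: pselect. Qed.

Lemma lift_sec_map u : U u -> lift_map (lift_sec u) = mu u.
Proof. by rewrite /lift_sec; case: pselect. Qed.

Lemma lift_sec1 : lift_sec 1%g = 1%g.
Proof.
apply: lift_group_inj => [|y]; first by rewrite lift_sec_base.
by rewrite lift_sec_map ?mu1.
Qed.

Let near_mulg (g : G) (W : set G) : nbhs g W ->
  \forall u \near 1%g, W (u * g)%g.
Proof.
move=> gW; have : {for 1%g, continuous (fun u : G => (u * g)%g)}.
  by apply: lie_mul_continuous; [exact: cvg_id|exact: cst_continuous].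
by apply; rewrite mul1g.
Qed.

Let near_mulVg (g : G) (W : set G) : nbhs 1%g W ->
  \forall u \near g, W (u * g^-1)%g.
Proof.
move=> gW; have : {for g, continuous (fun u : G => (u * g^-1)%g)}.
  by apply: lie_mul_continuous; [exact: cvg_id|exact: cst_continuous].
by apply; rewrite mulgV.
Qed.

Let near_conjg (g : G) (W : set G) : nbhs 1%g W ->
  \forall u \near 1%g, W (g * u * g^-1)%g.
Proof.
move=> gW; have : {for 1%g, continuous (fun u : G => (g * u * g^-1)%g)}.
  apply: lie_mul_continuous; last exact: cst_continuous.
  by apply: lie_mul_continuous; [exact: cst_continuous|exact: cvg_id].
by apply; rewrite mulg1 mulgV.
Qed.

(** [U] need not be closed under products, so [v] is taken near 1, depending on [u]: a whole path
    from 1 to [v], multiplied by [u], must remain in [U]. Translates of the section thus fit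
    together on overlaps, which yields the topology and the openness of sheets. *)
Lemma lift_sec_mul_near u : U u -> \forall v \near 1%g,
  [/\ U v, U (v * u)%g & (lift_sec v * lift_sec u = lift_sec (v * u))%g].
Proof.
move=> Uu.
have Wn : nbhs 1%g (U `&` [set v | U (v * u)%g]).
  by apply: filterI => //; apply: near_mulg; exact: open_nbhs_nbhs.
apply: filterS2 Wn (pathU Wn) => v [Uv Uvu] [c [cc c0 c1 cW]].
split=> //; apply: lift_group_inj => [|y].
  by rewrite lift_baseM !lift_sec_base.
rewrite lift_mapM !lift_sec_map // -c1.
have := @mu_path c (fun t => mu (c t * u)%g y) cc.
rewrite c0 mul1g => -> // => [t|t|t _].
- apply: (@mu_continuous _ (fun t => c t * u)%g (fun=> y));
    last by have [] := cW t.
    apply: lie_mul_continuous; [exact: cc|exact: cst_continuous].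
  exact: cst_continuous.
- by have [] := cW t.
- by rewrite !pmu ?actM //; have [] := cW t.
Qed.

(** Both factors vary here, as the continuity of product and inverse demands; the two paths are
    multiplied pointwise. *)
Lemma lift_sec_mul_near2 : \forall z \near ((1%g, 1%g) : G * G),
  [/\ U z.1, U z.2, U (z.1 * z.2)%g &
    (lift_sec z.1 * lift_sec z.2 = lift_sec (z.1 * z.2))%g].
Proof.
have mc : {for (1%g, 1%g), continuous (fun z : G * G => z.1 * z.2)%g}.
  by apply: lie_mul_continuous; [exact: continuous_fst|exact: continuous_snd].
have : nbhs ((1%g, 1%g) : G * G) (fun z => U (z.1 * z.2)%g).
  by apply: mc; rewrite mulg1.
move=> [[P Q] [/= P1 Q1] PQU].
have Wn : nbhs 1%g (U `&` (P `&` Q)) by apply: filterI => //; exact: filterI.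
have Sn := pathU Wn.
exists ((U `&` (P `&` Q) `&` path_from_one R (U `&` (P `&` Q))),
  (U `&` (P `&` Q) `&` path_from_one R (U `&` (P `&` Q)))).
  by split; apply: filterI.
move=> [u v] [/= [[Uu [Pu Qu]] [c [cc c0 c1 cW]]]].
move=> [[Uv [Pv Qv]] [d [dc d0 d1 dW]]].
have Uuv := PQU (u, v) (conj Pu Qv).
have Ucd t : U (c t * d t)%g.
  by apply: (PQU (c t, d t)); split; [have [_ []] := cW t|have [_ []] := dW t].
split => //; apply: lift_group_inj => [|y].
  by rewrite lift_baseM !lift_sec_base.
rewrite lift_mapM !lift_sec_map // -c1 -d1.
have := @mu_path (fun t => c t * d t)%g (fun t => mu (c t) (mu (d t) y)).
rewrite c0 d0 mulg1 !mu1 => -> // => [t|t|t _].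
- by apply: lie_mul_continuous; [exact: cc|exact: dc].
- apply: (@mu_continuous _ c (fun t => mu (d t) y));
    [exact: cc| |by have [] := cW t].
  apply: (@mu_continuous _ d (fun=> y)); first exact: dc.
    exact: cst_continuous.
  by have [] := dW t.
- by rewrite !pmu ?actM //; [have [] := dW t|have [] := cW t].
Qed.

(** Neighbourhoods will be right translates of the section, so left multiplication by [x] is under
    control only once [x] has been moved past the section. *)
Lemma lift_sec_conj_near (x : lift_group) : \forall v \near 1%g,
  [/\ U v, U (lift_base x * v * (lift_base x)^-1)%g &
  (x * lift_sec v = lift_sec (lift_base x * v * (lift_base x)^-1) * x)%g].
Proof.
set g := lift_base x.
have Wn : nbhs 1%g (U `&` [set v | U (g * v * g^-1)%g]).
  by apply: filterI => //; exact: near_conjg.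
apply: filterS2 Wn (pathU Wn) => v [Uv Uvu] [c [cc c0 c1 cW]].
(* Multiplied by [x^-1], the left side is the end of a lift along the path [g * c t * g^-1], to
   which [mu_path] applies. *)
split=> //; apply: (mulIg x^-1%g); rewrite -[RHS]mulgA mulgV mulg1.
apply: lift_group_inj => [|y].
  by rewrite !lift_baseM !lift_sec_base.
rewrite !lift_mapM !lift_sec_map // -c1.
have := @mu_path (fun t => g * c t * g^-1)%g
  (fun t => lift_map x (mu (c t) (lift_map x^-1%g y))).
rewrite c0 mulg1 mulgV mu1 lift_mapVK => -> // => [t|t|t|t _].
- apply: (@lie_mul_continuous _ _ _ _ (fun t => g * c t)%g (fun=> g^-1)%g).
    apply: (@lie_mul_continuous _ _ _ _ (fun=> g) c); last exact: cc.
    exact: cst_continuous.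
  exact: cst_continuous.
- apply: (@continuous_comp _ _ _ (fun t => mu (c t) (lift_map x^-1%g y))
    (lift_map x)); last exact: lift_map_continuous.
  apply: (@mu_continuous _ c (fun=> lift_map x^-1%g y)); first exact: cc.
    exact: cst_continuous.
  by have [] := cW t.
- by have [] := cW t.
- by rewrite lift_mapE pmu ?lift_mapE ?actM //; have [] := cW t.
Qed.

Definition lift_nbhs (x : lift_group) : set_system lift_group :=
  (fun u => lift_sec u * x)%g @ (1%g : G).

HB.instance Definition _ := hasNbhs.Build lift_group lift_nbhs.

Let lift_nbhs_filter (x : lift_group) : ProperFilter (nbhs x).
Proof. exact: fmap_proper_filter. Qed.

Let lift_nbhs_singleton (x : lift_group) (A : set lift_group) : nbhs x A -> A x.
Proof. by move=> /nbhs_singleton /=; rewrite lift_sec1 mul1g. Qed.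

Let lift_nbhs_nbhs (x : lift_group) (A : set lift_group) :
  nbhs x A -> nbhs x (nbhs^~ A).
Proof.
move=> xA; change (\forall u \near 1%g, nbhs (lift_sec u * x)%g A).
have xA' := nbhs_interior (xA : nbhs 1%g [set u : G | A (lift_sec u * x)%g]).
apply: filterS2 nU1 xA' => u Uu uA.
have := near_mulg uA.
apply: filterS2 (lift_sec_mul_near Uu) => v [Uv Uvu e].
by rewrite /= mulgA e.
Qed.

HB.instance Definition _ := Nbhs_isNbhsTopological.Build lift_group
  lift_nbhs_filter lift_nbhs_singleton lift_nbhs_nbhs.

Lemma lift_nbhsE (x : lift_group) (A : set lift_group) :
  nbhs x A = (\forall u \near 1%g, A (lift_sec u * x)%g).
Proof. by []. Qed.

Lemma lift_base_continuous : continuous lift_base.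
Proof.
move=> x W Wx; change (\forall u \near 1%g, W (lift_base (lift_sec u * x)%g)).
apply: filterS2 nU1 (near_mulg Wx) => u Uu.
by rewrite lift_baseM lift_sec_base.
Qed.

Lemma lift_mul_continuous :
  continuous (fun z : lift_group * lift_group => z.1 * z.2)%g.
Proof.
move=> [x y] W Wxy.
change (nbhs (x, y) (fun z : lift_group * lift_group => W (z.1 * z.2)%g)).
(* Near [(x, y)] the product stays on one translate: [(lift_sec u * x) * (lift_sec v * y) = lift_sec
   (u * (g * v * g^-1)) * (x * y)]. *)
pose g := lift_base x.
have cc : {for (1%g, 1%g), continuous
    (fun z : G * G => (z.1, g * z.2 * g^-1)%g)}.
  apply: continuous_pair_at; first exact: continuous_fst.
  apply: lie_mul_continuous; last exact: cst_continuous.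
  by apply: lie_mul_continuous; [exact: cst_continuous|exact: continuous_snd].
have mc : {for (1%g, 1%g), continuous (fun z : G * G => z.1 * z.2)%g}.
  by apply: lie_mul_continuous; [exact: continuous_fst|exact: continuous_snd].
have e1 : (g * 1 * g^-1)%g = 1%g by rewrite mulg1 mulgV.
have h1 : \forall z \near ((1%g, 1%g) : G * G),
    (lift_sec z.1 * lift_sec (g * z.2 * g^-1) =
     lift_sec (z.1 * (g * z.2 * g^-1)))%g.
  move: cc; rewrite /prop_for /continuous_at /= e1.
  move=> /(_ _ lift_sec_mul_near2) h.
  by apply: filterS (h : nbhs ((1%g, 1%g) : G * G) _) => z [].
have h2 : \forall z \near ((1%g, 1%g) : G * G),
    (x * lift_sec z.2 = lift_sec (g * z.2 * g^-1) * x)%g.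
  have : nbhs ((1%g, 1%g) : G * G) (snd @^-1` [set v : G |
      (x * lift_sec v = lift_sec (g * v * g^-1) * x)%g]).
    by apply: continuous_snd; apply: filterS (lift_sec_conj_near x) => v [].
  by apply: filterS => z.
have h3 : \forall z \near ((1%g, 1%g) : G * G),
    W (lift_sec (z.1 * (g * z.2 * g^-1)) * (x * y))%g.
  have : nbhs (1 * (g * 1 * g^-1))%g [set u : G | W (lift_sec u * (x * y))%g].
    by rewrite e1 mulg1.
  have mcc : {for (1%g, 1%g), continuous
      (fun z : G * G => z.1 * (g * z.2 * g^-1))%g}.
    apply: lie_mul_continuous; first exact: continuous_fst.
    apply: lie_mul_continuous; last exact: cst_continuous.
    by apply: lie_mul_continuous; [exact: cst_continuous|exact: continuous_snd].
  by move=> /mcc.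
have : \forall z \near ((1%g, 1%g) : G * G),
    W ((lift_sec z.1 * x) * (lift_sec z.2 * y))%g.
  apply: filterS3 h1 h2 h3 => z e2 e3.
  rewrite -e2; congr W; rewrite -!mulgA; congr (_ * _)%g.
  by rewrite !mulgA e3.
move=> [[P Q] [/= P1 Q1] PQW].
exists ([set (lift_sec u * x)%g | u in P], [set (lift_sec u * y)%g | u in Q]).
  split => /=; rewrite lift_nbhsE.
    by apply: filterS P1 => u Pu; exists u.
  by apply: filterS Q1 => u Qu; exists u.
by move=> [_ _] [/= [u Pu <-] [v Qv <-]]; exact: (PQW (u, v)).
Qed.

Lemma lift_inv_continuous : continuous (fun x : lift_group => x^-1)%g.
Proof.
move=> x W Wx; change (\forall u \near 1%g, W (lift_sec u * x)^-1%g).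
(* Inverses of points near [x] lie on a translate of the section: [(lift_sec u * x)^-1 = lift_sec (g
   * u^-1 * g^-1) * x^-1] for [u] near 1. *)
pose g := lift_base x^-1%g.
have vc : {for 1%g, continuous (fun u : G => (u, u^-1)%g)}.
  apply: continuous_pair_at; first exact: cvg_id.
  by apply: lie_inv_continuous; exact: cvg_id.
have h1 : \forall u \near 1%g, (lift_sec u * lift_sec u^-1 = 1)%g.
  move: vc; rewrite /prop_for /continuous_at invg1.
  move=> /(_ _ lift_sec_mul_near2) h.
  apply: filterS (h : nbhs (1%g : G) _) => u [_ _ _].
  by rewrite /= mulgV lift_sec1.
have ic : {for 1%g, continuous (fun u : G => u^-1)%g}.
  by apply: lie_inv_continuous; exact: cvg_id.
have h2 : \forall u \near 1%g,
    (x^-1 * lift_sec u^-1 = lift_sec (g * u^-1 * g^-1) * x^-1)%g.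
  move: (ic); rewrite /prop_for /continuous_at invg1.
  move=> /(_ _ (lift_sec_conj_near x^-1%g)) h.
  by apply: filterS (h : nbhs (1%g : G) _) => u [].
have h3 : \forall u \near 1%g, W (lift_sec (g * u^-1 * g^-1) * x^-1)%g.
  have cc : {for 1%g, continuous (fun u : G => (g * u^-1 * g^-1)%g)}.
    apply: lie_mul_continuous; last exact: cst_continuous.
    by apply: lie_mul_continuous; [exact: cst_continuous|exact: ic].
  have : nbhs (g * 1^-1 * g^-1)%g [set u : G | W (lift_sec u * x^-1)%g].
    by rewrite invg1 mulg1 mulgV.
  by move=> /cc.
apply: filterS3 h1 h2 h3 => u e1 e2.
rewrite -e2 => /=; rewrite invgM.
suff -> : (lift_sec u^-1 = (lift_sec u)^-1)%g by [].
by apply: (mulgI (lift_sec u)); rewrite e1 mulgV.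
Qed.

(** Near [x] the action is [mu u] after [lift_map x], and [mu] is jointly continuous. *)
Lemma lift_action_continuous :
  continuous (fun z : lift_group * Y' => lift_map z.1 z.2).
Proof.
move=> [x y] W Wxy.
have mc : {for (1%g, y), continuous
    (fun z : G * Y' => mu z.1 (lift_map x z.2))}.
  apply: (@mu_continuous _ fst (fun z => lift_map x z.2)) => //.
    exact: continuous_fst.
  apply: (@continuous_comp _ _ _ snd (lift_map x)); first exact: continuous_snd.
  exact: lift_map_continuous.
have : nbhs (1%g : G, y) (fun z : G * Y' => W (mu z.1 (lift_map x z.2))).
  by apply: mc; rewrite /= mu1.
move=> [[P Q] [/= P1 Qy] PQW].
exists ([set (lift_sec u * x)%g | u in P `&` U], Q).
  split => //=; rewrite lift_nbhsE.
  by apply: filterS2 P1 nU1 => u Pu Uu; exists u.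
move=> [_ z] [/= [u [Pu Uu] <-] Qz].
by rewrite lift_mapM lift_sec_map //; exact: (PQW (u, z)).
Qed.

Definition lift_sheet (x : lift_group) : set lift_group :=
  [set (lift_sec u * x)%g | u in U].

Lemma lift_sheet_open x : open (lift_sheet x).
Proof.
rewrite openE => _ [u Uu <-]; rewrite /interior lift_nbhsE.
apply: filterS (lift_sec_mul_near Uu) => v [Uv Uvu e].
by exists (v * u)%g => //; rewrite -e mulgA.
Qed.

Lemma lift_sheetP x y : lift_sheet x y <->
  U (lift_base y * (lift_base x)^-1)%g /\
  y = (lift_sec (lift_base y * (lift_base x)^-1) * x)%g.
Proof.
split=> [[u Uu <-]|[h1 h2]]; last by exists (lift_base y * (lift_base x)^-1)%g.
by rewrite lift_baseM lift_sec_base // mulgK.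
Qed.

Lemma lift_base_open (W : set lift_group) : open W -> open (lift_base @` W).
Proof.
rewrite !openE => oW _ [x Wx <-]; rewrite /interior.
have h := oW x Wx.
have {}h : \forall u \near 1%g, U u /\ W (lift_sec u * x)%g.
  by apply: filterI => //; exact: h.
apply: filterS (near_mulVg (lift_base x) h) => g [Ug Wg].
by exists (lift_sec (g * (lift_base x)^-1) * x)%g => //;
  rewrite lift_baseM lift_sec_base // mulgVK.
Qed.

Lemma lift_base_evenly_covered g :
  open_nbhs g [set k | U (k * g^-1)%g] /\
  evenly_covered lift_base [set k | U (k * g^-1)%g].
Proof.
split.
  split; last by rewrite /= mulgV.
  apply: open_comp => // k _.
  by apply: (@lie_mul_continuous _ _ _ _ id (fun=> g^-1)%g);
    [exact: cvg_id|exact: cst_continuous].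
exists [set lift_sheet x | x in lift_base @^-1` [set g]]; split.
- move=> _ _ [x xg <-] [y yg <-] [z [/lift_sheetP[Uz zx] /lift_sheetP[_ zy]]].
  suff -> : x = y by [].
  rewrite /= in xg yg; rewrite xg in zx; rewrite yg in zy.
  apply: (mulgI (lift_sec (lift_base z * g^-1)%g)).
  by rewrite -zx -zy.
- apply/seteqP; split=> [k [_ [x xg <-] [u Uu <-]]|k Uk] /=.
    by rewrite ?lift_baseM lift_sec_base // xg mulgK.
  (* The centre, over [g], of the sheet through [k]: the value of the section leading from [g] to
     [lift_base k] is divided off. *)
  pose x := ((lift_sec (lift_base k * g^-1))^-1 * k)%g.
  have xg : lift_base x = g.
    rewrite lift_baseM lift_baseV lift_sec_base //.
    by rewrite invgM invgK -mulgA mulVg mulg1.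
  exists (lift_sheet x); first by exists x.
  exists (lift_base k * g^-1)%g => //.
  by rewrite /x mulgA mulgV mul1g.
- move=> _ [x /= xg <-]; split; [exact: lift_sheet_open| |]; last first.
    by move=> W oW _; exact: lift_base_open.
  split.
  + by move=> _ [u Uu <-]; rewrite /= ?lift_baseM lift_sec_base // xg mulgK.
  + move=> y z /set_mem/lift_sheetP[_ ey] /set_mem/lift_sheetP[_ ez] /= yz.
    by rewrite [LHS]ey [RHS]ez yz.
  + move=> k Uk; exists (lift_sec (k * g^-1) * x)%g.
      by exists (k * g^-1)%g.
    by rewrite ?lift_baseM lift_sec_base // xg mulgVK.
Qed.

(** Distinct points over the same element of [G] are the centres of disjoint sheets; other points
    are separated in [G]. *)
Lemma lift_hausdorff : hausdorff_space lift_group.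
Proof.
rewrite open_hausdorff => x y xy.
have [e|/eqP ne] := pselect (lift_base x = lift_base y).
  have sx z : lift_sheet z z.
    by apply/lift_sheetP; rewrite mulgV lift_sec1 mul1g.
  exists (lift_sheet x, lift_sheet y); first by rewrite !inE; split; exact: sx.
  split; do ?exact: lift_sheet_open.
  apply/eqP; rewrite predeqE => z.
  split => // -[/lift_sheetP[_ zx] /lift_sheetP[_ zy]].
  rewrite e in zx; move/eqP: xy; apply.
  apply: (mulgI (lift_sec (lift_base z * (lift_base y)^-1)%g)).
  by rewrite -zx -zy.
have hG : hausdorff_space G by case: (lie_atlasP G).
move: hG ne; rewrite open_hausdorff => hG /hG[[A B] /=].
rewrite !inE => -[xA yB] [oA oB AB].
exists (lift_base @^-1` A, lift_base @^-1` B); first by rewrite !inE.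
split; do ?[by apply: open_comp => // z _; exact: lift_base_continuous].
by rewrite -preimage_setI AB preimage_set0.
Qed.

Section Connected.
Hypothesis connG : connected [set: G].

(** The image is a subgroup containing the neighbourhood [U] of 1; by translation both it and its
    complement are open, and [G] is connected. *)
Lemma lift_base_surj g : exists x, lift_base x = g.
Proof.
suff : [set lift_base x | x in setT] g by move=> [x _ <-]; exists x.
suff -> : [set lift_base x | x in setT] = setT by [].
apply: connG; first by exists 1%g; exists 1%g.
  exists [set lift_base x | x in setT]; last by rewrite setTI.
  exact: lift_base_open openT.
exists [set lift_base x | x in setT]; last by rewrite setTI.
rewrite -[X in closed X]setCK; apply: open_closedC; rewrite openE => k nk.
apply: filterS (near_mulVg k nU1) => k' Uk' [x _ xk']; apply: nk.
exists ((lift_sec (k' * k^-1))^-1 * x)%g => //.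
rewrite lift_baseM lift_baseV lift_sec_base // xk'.
by rewrite invgM invgK -mulgA mulVg mulg1.
Qed.

Lemma lift_base_covering : covering_map lift_base.
Proof.
split; first exact: lift_base_continuous.
  by move=> g _; have [x xg] := lift_base_surj g; exists x.
move=> g; have [h1 h2] := lift_base_evenly_covered g.
by exists [set k | U (k * g^-1)%g].
Qed.

(** Run at speed [clamp t], the isotopy reaches at time 1 its stage of time [clamp t], so every
    stage is itself an element of the group. *)
Let isotopy_path c f (t : R) : isotopy_lift c f ->
  action_lift (c (clamp t)) (fun y => f (clamp t, y)).
Proof.
move=> [cc fc c0 f0 pf].
exists (fun s => c (clamp t * s)), (fun z => f (clamp t * z.1, z.2)); split.
- split.
  + move=> s; apply: (@continuous_comp _ _ _ (fun s => clamp t * s) c).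
      by apply: cvgM; [exact: cvg_cst|exact: cvg_id].
    exact: cc.
  + move=> z; apply: (@continuous_comp _ _ _
      (fun z : R * Y' => (clamp t * z.1, z.2)) f); last exact: fc.
    apply: (@continuous_pair_at _ _ _ (fun z : R * Y' => clamp t * z.1) snd).
      by apply: cvgM; [exact: cvg_cst|exact: continuous_fst].
    exact: continuous_snd.
  + by rewrite mulr0.
  + by move=> y /=; rewrite mulr0.
  + move=> s y /andP[s0 s1] /=; apply: pf.
    have /andP[t0 t1] := clamp01 t.
    by rewrite mulr_ge0 //= mulr_ile1.
- by rewrite mulr1.
- by rewrite /= mulr1.
Qed.

(** Near [t0] the stage at [t] equals [lift_sec (C t)] times the stage at [t0], by unique lifting
    along the isotopy between the two times; so it depends on [t] only through the section and the
    continuous path [C]. *)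
Let isotopy_path_continuous c f (h : isotopy_lift c f) :
  continuous (fun t => LiftGroup (isotopy_path t h)).
Proof.
have [cc fc c0 f0 pf] := h.
have kc : continuous (fun t => c (clamp t)).
  by move=> t; apply: continuous_comp; [exact: clamp_continuous|exact: cc].
move=> t0 W Wt0.
pose C t := (c (clamp t) * (c (clamp t0))^-1)%g.
have Cc : continuous C.
  move=> t; apply: (@lie_mul_continuous _ _ _ _ (fun t => c (clamp t))
    (fun=> (c (clamp t0))^-1)%g); [exact: kc|exact: cst_continuous].
have C0 : C t0 = 1%g by rewrite /C mulgV.
have CU : nbhs t0 (C @^-1` U) by apply: Cc; rewrite C0.
have CW : nbhs t0 (C @^-1` [set u : G |
    W (lift_sec u * LiftGroup (isotopy_path t0 h))%g]).
  by apply: Cc; rewrite C0.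
have [e /= e0 eU] : exists2 e : R, 0 < e & ball t0 e `<=` C @^-1` U.
  exact/nbhs_ballP.
have te : nbhs t0 (ball t0 e) by exact: nbhsx_ballx.
change (nbhs t0 [set t | W (LiftGroup (isotopy_path t h))]).
apply: filterS2 te CW => t te /=; congr W.
have Ut : U (C t) by exact: eU.
apply: lift_group_inj => [|y].
  by rewrite lift_baseM lift_sec_base //= mulgVK.
rewrite lift_mapM lift_sec_map //=.
(* [l] runs from [t0] to [t], clamped so that it stays in the ball on which [C] takes values in
   [U]. *)
pose l (s : R) : R := t0 + clamp s * (t - t0).
have lc : continuous l.
  move=> s; apply: cvgD; first exact: cvg_cst.
  by apply: cvgM; [exact: clamp_continuous|exact: cvg_cst].
have l0 : l 0 = t0 by rewrite /l clamp_id ?lexx ?ler01 // mul0r addr0.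
have l1 : l 1 = t.
  by rewrite /l clamp_id ?lexx ?ler01 // mul1r addrC subrK.
have := @mu_path (C \o l) (fun s => f (clamp (l s), y)).
rewrite /= l0 l1 => -> // => [s|s|s|s _].
- by apply: continuous_comp; [exact: lc|exact: Cc].
- apply: (@continuous_comp _ _ _ (fun s => clamp (l s)) (fun r => f (r, y))).
    by apply: (continuous_comp (lc s)); exact: clamp_continuous.
  by have [] := slice_continuous (fc (clamp (l s), y)).
- apply: eU; move: te; rewrite -!ball_normE /ball_ /= /l opprD addNKr normrN.
  rewrite normrM distrC; apply: le_lt_trans.
  have /andP[s0 s1] := clamp01 s.
  by rewrite ler_piMl // ger0_norm.
- rewrite !pf ?clamp01 // -actM /C mulgVK //.
Qed.

Lemma lift_connected : connected [set: lift_group].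
Proof.
have /choice[A AP] : forall x : lift_group,
    exists A : set lift_group, [/\ connected A, A 1%g & A x].
  move=> x; have [c [f [h xc xf]]] := lift_mapP x.
  exists ((fun t => LiftGroup (isotopy_path t h)) @` `[0, 1]); split.
  - apply: connected_continuous_connected; first exact: segment_connected.
    exact/continuous_subspaceT/isotopy_path_continuous.
  - exists 0; first by rewrite /= in_itv /= lexx ler01.
    have [_ _ c0 f0 _] := h.
    apply: lift_group_inj => [|y] /=; rewrite clamp_id ?lexx ?ler01 //.
  - exists 1; first by rewrite /= in_itv /= lexx ler01.
    apply: lift_group_inj => [|y] /=; rewrite clamp_id ?lexx ?ler01 //.
    by rewrite xf.
have -> : [set: lift_group] = \bigcup_(x in setT) A x.
  by apply/seteqP; split => // x _; exists x => //; have [] := AP x.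
apply: bigcup_connected => [|x _]; last by have [] := AP x.
by exists 1%g => x _; have [] := AP x.
Qed.

Hypothesis connY : connected [set: Y].
Hypothesis finp : finite_fibers p.

Lemma lift_finite_fibers : finite_fibers lift_base.
Proof.
move=> g.
have [[y0 _]|Y0] := pselect ([set: Y] !=set0).
  apply: (@finite_set_eval _ _ _ _ lift_map (p @^-1` [set y0])
    (fun=> p @^-1` [set a g y0])) => //.
  - by move=> x y /= xg yy0; rewrite lift_mapE xg yy0.
  - move=> x y /= xg yg xy; apply: lift_group_inj => [|z]; first by rewrite xg.
    have := @covering_lifts_eq _ _ _ _ p p (lift_map x) (lift_map y) y0 cp finp
      connY lp hY' (@lift_map_continuous x) (@lift_map_continuous y).
    by move=> -> // w; rewrite !lift_mapE xg yg.
(* If [Y] is empty then so is [Y'], and an element is determined by its image in [G]. *)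
apply: (@finite_set_eval _ _ Y' _ lift_map set0 (fun=> setT)) => //.
move=> x y /= xg yg _; apply: lift_group_inj => [|z]; first by rewrite xg.
by exfalso; apply: Y0; exists (p z).
Qed.

Let aG := manifold_atlas (lie_atlasP G).
Let aY := manifold_atlas (atlasP Y).
Let aY' := manifold_atlas (atlasP Y').

Lemma lift_second_countable : @second_countable lift_group.
Proof.
apply: covering_second_countable lift_base_covering lift_finite_fibers _.
by case: (lie_atlasP G).
Qed.

Let lq := covering_local_homeo lift_base_covering.

Definition lift_atlas := pullback_atlas lift_base (lie_atlas G).

Lemma lift_atlasP : is_manifold (@differentiable_on K) lift_atlas.
Proof.
exact: (pullback_atlas_manifold aG lq lift_hausdorff lift_second_countable).
Qed.

Let aL := manifold_atlas lift_atlasP.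

Lemma lift_pulled_back : pulled_back lift_base lift_atlas (lie_atlas G).
Proof.
exact: (pullback_atlas_pulled_back aG lq lift_hausdorff lift_second_countable).
Qed.

Lemma lift_base_hol x : hol_at lift_atlas (lie_atlas G) lift_base x.
Proof. exact: (pulled_back_hol aG lq lift_pulled_back). Qed.

Lemma lift_mul_hol : regular_map_on (@differentiable_on K)
  (prod_atlas lift_atlas lift_atlas) lift_atlas setT
  (fun z : lift_group * lift_group => z.1 * z.2)%g.
Proof.
apply/holomorphic_onP => z _.
apply: (hol_at_lift aG lq lift_pulled_back (prod_is_chart aL aL)).
  exact: lift_mul_continuous.
have h := hol_at_prod_map aL aL (lift_base_hol z.1) (lift_base_hol z.2).
exact: (hol_at_comp (prod_is_chart aL aL) (prod_is_chart aG aG)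
  (prod_atlas_cover aG aG) h (lie_mul_hol _)).
Qed.

Lemma lift_inv_hol : regular_map_on (@differentiable_on K)
  lift_atlas lift_atlas setT (fun x : lift_group => x^-1)%g.
Proof.
apply/holomorphic_onP => x _.
apply: (hol_at_lift aG lq lift_pulled_back (atlas_chart aL)).
  exact: lift_inv_continuous.
exact: (hol_at_comp (atlas_chart aL) (atlas_chart aG) (atlas_cover aG)
  (lift_base_hol x) (lie_inv_hol _)).
Qed.

Definition lift_lie_group : holLieGroup K m :=
  @LieGroup K (@differentiable_on K) m lift_group lift_atlas lift_atlasP
    lift_mul_hol lift_inv_hol.

Hypothesis pbp : pulled_back p (atlas Y') (atlas Y).

Lemma lift_act_hol : holomorphic_on
  (prod_atlas (lie_atlas lift_lie_group) (atlas Y')) (atlas Y') setT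
  (fun z : lift_lie_group * Y' => lift_map z.1 z.2).
Proof.
apply/holomorphic_onP => z _.
apply: (hol_at_lift aY lp pbp (prod_is_chart aL aY')).
  exact: lift_action_continuous.
have -> : p \o (fun z : lift_lie_group * Y' => lift_map z.1 z.2) =
    (fun z => a z.1 z.2) \o (fun z => (lift_base z.1, p z.2)).
  by apply/funext => w; exact: lift_mapE.
have h := hol_at_prod_map aL aY' (lift_base_hol z.1)
  (pulled_back_hol aY lp pbp z.2).
exact: (hol_at_comp (prod_is_chart aL aY') (prod_is_chart aG aY)
  (prod_atlas_cover aG aY) h (act_hol a _)).
Qed.

Definition lift_lie_action : holomorphic_action lift_lie_group Y' :=
  @HolomorphicAction K m n lift_lie_group Y' lift_map lift_map1 lift_mapM
    lift_act_hol.

(** As [p] is onto, an element acting trivially on [Y'] has an image acting trivially on [Y], and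
    that image is 1 by effectiveness of [a]. *)
Lemma lift_effective : effective a -> effective lift_lie_action.
Proof.
move=> effa x xid; apply: lift_group_inj => [|y]; last exact: xid.
apply: effa => y; case: cp => _ /(_ y I)[y' _ <-] _.
by rewrite -lift_mapE; congr p; exact: xid.
Qed.

Lemma finite_covering_group : effective a ->
  exists (G' : holLieGroup K m) (q : G' -> G) (a' : holomorphic_action G' Y'),
    [/\ covering_group q, finite_fibers q, effective a' &
      action_covers q p a' a].
Proof.
move=> effa; exists lift_lie_group, lift_base, lift_lie_action; split.
- split.
  + exact: lift_connected.
  + exact: lift_baseM.
  + exact: lift_base_covering.
  + exact: lift_pulled_back.
- exact: lift_finite_fibers.
- exact: lift_effective.
- exact: lift_mapE.
Qed.

End Connected.

End ActionLifts.

(** * The real line inside the complex scalars *)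

Section RealScalars.
Variable R : realType.

Definition real_scalar (t : R) : complex_field R := (t%:C)%C.

Lemma real_scalarB t s : real_scalar t - real_scalar s = real_scalar (t - s).
Proof. by rewrite /real_scalar rmorphB. Qed.

Lemma real_scalar_norm t : `|real_scalar t| = real_scalar `|t|.
Proof. by rewrite /real_scalar normc_def /= expr0n addr0 sqrtr_sqr. Qed.

Lemma real_scalar_continuous : continuous real_scalar.
Proof.
move=> t W /nbhs_ballP[e /= e0 eW].
(* Radii of balls are complex here; a positive one has zero imaginary part and so comes from a real
   radius. *)
have [d d0 dE] : exists2 d : R, 0 < d & real_scalar d = e.
  case: e e0 {eW} => x y; rewrite ltcE /= => /andP[/eqP y0 x0].
  by exists x => //; rewrite y0.
change (nbhs t (real_scalar @^-1` W)); apply/nbhs_ballP; exists d => // s.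
rewrite -ball_normE /ball_ /= => ts; apply: eW.
rewrite -ball_normE /ball_ /= real_scalarB real_scalar_norm -dE.
by rewrite /real_scalar ltcR.
Qed.

Lemma real_scalar_le1 t : 0 <= t <= 1 -> `|real_scalar t| <= 1.
Proof.
move=> /andP[t0 t1]; rewrite real_scalar_norm ger0_norm //.
by rewrite /real_scalar -(rmorph1 (real_complex R)) lecR.
Qed.

End RealScalars.

Theorem proposition3p8 (R : realType) (m n : nat)
    (G : complexLieGroup R m) (Y : complexManifold R n)
    (a : holomorphic_action G Y)
    (connG : connected [set: G]) (redG : reductive G)
    (connY : connected [set: Y]) (effa : effective a) (ella : elliptic a)
    (Y' : complexManifold R n) (p : Y' -> Y) (covp : manifold_covering p) :
  (forall (G' : complexLieGroup R m) (q : G' -> G)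
      (a' : holomorphic_action G' Y'),
    covering_group q -> finite_fibers q ->
    effective a' -> action_covers q p a' a ->
    elliptic a') /\
  (finite_fibers p ->
    exists (G' : complexLieGroup R m) (q : G' -> G)
      (a' : holomorphic_action G' Y'),
      [/\ covering_group q, finite_fibers q,
          effective a', action_covers q p a' a & elliptic a']).
Proof.
(* Both assertions end in this step; [q] is holomorphic because the structure of [G'] is pulled back
   along it. *)
have lift_elliptic (G' : complexLieGroup R m) (q : G' -> G)
    (a' : holomorphic_action G' Y') :
    covering_group q -> action_covers q p a' a -> elliptic a'.
  move=> [_ qM covq pbq] qpa.
  apply: (elliptic_covering (@real_scalar_continuous R) (rmorph0 _) (rmorph1 _)
    covp _ qpa qM ella) => g.
  exact: (pulled_back_hol (manifold_atlas (lie_atlasP G))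
    (covering_local_homeo covq) pbq).
split=> [G' q a' covq _ _ qpa|finp]; first exact: lift_elliptic qpa.
have [cp pbp] := covp.
have [U [mu [U1 pathU muc pmu [mu1 UpathU]]]] :=
  local_action_lift (@real_scalar_continuous R) (rmorph0 _) (rmorph1 _)
    (@real_scalar_le1 R) a cp.
have [G' [q [a' [covq finq effa' qpa]]]] :=
  finite_covering_group cp U1 pathU muc pmu mu1 UpathU connG connY finp pbp effa.
by exists G', q, a'; split => //; exact: lift_elliptic qpa.
Qed.
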